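(* Let $k\ge 3$ be a fixed integer. There is a deterministic algorithm which, given any $2$-colorable $k$-uniform hypergraph $\mathcal H$ on the vertex set $\{1,\dots,n\}$, outputs a proper $2$-coloring of $\mathcal H$, and whose average running time over all $2$-colorable $k$-uniform hypergraphs on $\{1,\dots,n\}$ is $n^{O(k)}$.
   Context: A $k$-uniform hypergraph ($k$-graph) $\mathcal H$ consists of a vertex set $V(\mathcal H)$ and a set $E(\mathcal H)$ of $k$-element subsets of $V(\mathcal H)$. A proper (legal) $2$-coloring is a map $c:V(\mathcal H)\to\{0,1\}$ such that no edge is monochromatic; $\mathcal H$ is $2$-colorable (bipartite) if it has one. For a deterministic algorithm $A$, $T_A(\mathcal H)$ denotes its running time on input $\mathcal H$, and the average running time $T_A(n)$ is the average of $T_A(\mathcal H)$ over all $2$-colorable $k$-graphs $\mathcal H$ on $\{1,\dots,n\}$ (uniform distribution). The algorithm may query whether a given $k$-tuple of vertices forms an edge. *)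

(* Defs.v *)
From mathcomp Require Import all_boot all_order all_algebra.
From mathcomp Require Import boolp.
Set Implicit Arguments. Unset Strict Implicit. Unset Printing Implicit Defensive.
Import GRing.Theory.

(* The vertex set {1, ..., n} is represented by 'I_n = {0, ..., n-1}. *)
Definition uniform (k n : nat) (H : {set {set 'I_n}}) : bool :=
  [forall e in H, #|e| == k].

Definition monochromatic (n : nat) (c : {ffun 'I_n -> bool}) (e : {set 'I_n}) :=
  [exists b : bool, forall v in e, c v == b].

Definition proper_coloring (n : nat) (H : {set {set 'I_n}})
    (c : {ffun 'I_n -> bool}) : bool :=
  [forall e in H, ~~ monochromatic c e].

Definition two_colorable (n : nat) (H : {set {set 'I_n}}) : bool :=
  [exists c : {ffun 'I_n -> bool}, proper_coloring H c].

(* Algorithms are while-programs on a random access machine (unit cost,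
   additive arithmetic only) with an edge oracle.  A program is a finite object
   independent of n and of the hypergraph. *)
Definition memory := nat -> nat.

Definition upd (m : memory) (a x : nat) : memory :=
  fun b => if b == a then x else m b.

Inductive program : Type :=
| Skip
| Const (x c : nat)           (* m[x] := c *)
| Add (x y z : nat)           (* m[x] := m[y] + m[z] *)
| Monus (x y z : nat)           (* m[x] := max (m[y] - m[z]) 0 *)
| Fetch (x y : nat)           (* m[x] := m[m[y]] *)
| Store (x y : nat)           (* m[m[x]] := m[y] *)
| Query (x y : nat)           (* m[x] := 1 if the k-tuple of vertices stored in
                                 cells m[y], ..., m[y]+k-1 forms an edge, else 0 *)
| Seq (p q : program)
| If (x : nat) (p q : program)   (* tests m[x] <> 0 *)
| While (x : nat) (p : program). (* tests m[x] <> 0 *)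

(* For a k-uniform H and a sequence s of length k, a repeated or out-of-range
   entry of s leaves a set with fewer than k elements, hence the answer false. *)
Definition edge_oracle (n : nat) (H : {set {set 'I_n}}) (s : seq nat) : bool :=
  [set v : 'I_n | val v \in s] \in H.

(* First component: the stack of programs still to be executed. *)
Definition config := (seq program * memory)%type.

Definition step (k n : nat) (H : {set {set 'I_n}}) (s : config) : config :=
  let: (K, m) := s in
  match K with
  | [::] => s
  | p :: K' =>
    match p with
    | Skip => (K', m)
    | Const x c => (K', upd m x c)
    | Add x y z => (K', upd m x (m y + m z))
    | Monus x y z => (K', upd m x (m y - m z))
    | Fetch x y => (K', upd m x (m (m y)))
    | Store x y => (K', upd m (m x) (m y))
    | Query x y =>
        (K', upd m x (edge_oracle H [seq m (m y + i) | i <- iota 0 k]))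
    | Seq p1 p2 => (p1 :: p2 :: K', m)
    | If x p1 p2 => ((if m x != 0 then p1 else p2) :: K', m)
    | While x p1 => (if m x != 0 then p1 :: p :: K' else K', m)
    end
  end.

Definition halted (s : config) : bool := nilp s.1.

(* At the start cell 0 holds n and every other cell holds 0. *)
Definition init (n : nat) (A : program) : config :=
  ([:: A], fun a => if a == 0 then n else 0).

Definition run (k n : nat) (A : program) (H : {set {set 'I_n}}) (t : nat) : config :=
  iter t (step k H) (init n A).

(* Cell 0 holds the address of the output array. *)
Definition output (n : nat) (s : config) : {ffun 'I_n -> bool} :=
  [ffun v : 'I_n => s.2 (s.2 0 + v) != 0].

Definition finds_proper_2coloring (k : nat) (A : program) : Prop :=
  forall (n : nat) (H : {set {set 'I_n}}), uniform k H -> two_colorable H ->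
  exists t : nat, halted (run k A H t) /\
    proper_coloring H (output n (run k A H t)).

(* The number of steps until A halts.  The value 0 for a run that does not halt
   is a dummy: it never occurs on 2-colorable inputs under
   finds_proper_2coloring. *)
Definition running_time (k n : nat) (A : program) (H : {set {set 'I_n}}) : nat :=
  match pselect (exists t, halted (run k A H t)) with
  | left h => ex_minn h
  | right _ => 0
  end.

Definition average_running_time (k : nat) (A : program) (n : nat) : rat :=
  ((\sum_(H : {set {set 'I_n}} | uniform k H && two_colorable H)
      running_time k A H)%N%:R
   / #|[set H : {set {set 'I_n}} | uniform k H && two_colorable H]|%:R)%R.

(* Main.v *)
Require Import Defs.
From mathcomp Require Import all_boot all_order all_algebra.
From mathcomp Require Import boolp zify ring lra.
Set Implicit Arguments. Unset Strict Implicit. Unset Printing Implicit Defensive.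
Import Order.TTheory GRing.Theory Num.Theory.

(** Let the codegree of two vertices u, v be the number of (k-1)-sets f such that
    both f + u and f + v are edges.  Fix a proper colouring c with both colours in
    use and a vertex u of the smaller class; a uniformly random hypergraph for
    which c is proper contains each k-set that c does not make monochromatic
    independently with probability 1/2.  The number of f for which f + u and f + v
    are both allowed is larger by at least C(b-1, k-1), b >= n/2 being the size of
    the other class, when v has the colour of u than when it has not.  So the
    expected codegrees of u with the two classes differ by order n^(k-1), and since
    k >= 3 an exponential moment bound shows that each codegree is on the correct
    side of a threshold except with probability at most 8^-n.  The algorithm tries,
    for all u and w, the colouring v |-> [codeg(u,v) > codeg(u,w)], which recovers
    c up to swapping the colours when w is suitably chosen, and falls back to an
    exhaustive search of time O(4^n poly(n)).

    No analysis of unbalanced colourings is needed: every c is proper for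
    2^|free k-sets of c| hypergraphs, which is at most the total number N of
    2-colourable ones, so a union bound over the 2^n colourings shows that at most
    n 4^-n N hypergraphs reach the exhaustive search. *)

(** * Tail bounds for random subsets *)

Section ProductWeights.
Local Open Scope ring_scope.

Lemma sum_powersetD1 (R : nmodType) (T : finType) (E : {set T}) (a : T)
    (g : {set T} -> R) :
  a \in E ->
  \sum_(A in powerset E) g A
    = \sum_(A in powerset (E :\ a)) (g A + g (a |: A)).
Proof.
move=> aE; rewrite big_split /= (bigID (fun A : {set T} => a \notin A)) /=.
congr (_ + _).
  by apply: eq_bigl => A; rewrite !powersetE subsetD1.
rewrite (reindex_onto (fun A => a |: A) (fun A => A :\ a)) /=.
  apply: eq_bigl => A; rewrite !powersetE subsetD1 negbK setU11 andbT subUset.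
  rewrite sub1set aE /=; congr (_ && _).
  have [aA|aA] := boolP (a \in A).
    by apply/eqP => /setP/(_ a); rewrite !inE eqxx aA.
  by rewrite setU1K // eqxx.
by move=> A /andP[_]; rewrite negbK => aA; rewrite setD1K.
Qed.

(** The pairs are disjoint, so each contributes an independent factor: of the four ways a subset can
    meet [{a, b}], three give [1] and one gives [x]. Multiplying by [4 ^+ size s] avoids
    division. *)
Lemma sum_powerset_pairs (R : comPzRingType) (T : finType) (x : R)
    (s : seq (T * T)) (E : {set T}) :
  uniq (map fst s ++ map snd s) -> {subset map fst s ++ map snd s <= E} ->
  (\sum_(A in powerset E)
     x ^+ count (fun p => (p.1 \in A) && (p.2 \in A)) s) * 4 ^+ size s
    = 2 ^+ #|E| * (3 + x) ^+ size s.
Proof.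
elim: s E => [|[a b] s IH] E /=.
  move=> _ _; rewrite !expr0 !mulr1 (eq_bigr (fun=> 1)) // sumr_const.
  by rewrite card_powerset natrX.
rewrite mem_cat /= inE !negb_or -!andbA.
case/and4P=> a1 ab a2 U sE.
move: (U); rewrite cat_uniq /= !negb_or -!andbA.
case/and5P=> us1 b1 us b2 us2.
have aE : a \in E by apply: sE; rewrite inE eqxx.
have bE : b \in E by apply: sE; rewrite inE mem_cat inE eqxx !orbT.
have bE' : b \in E :\ a by rewrite !inE bE eq_sym ab.
rewrite (sum_powersetD1 _ aE) (sum_powersetD1 _ bE').
set E' := E :\ a :\ b.
have cardE : #|E| = (#|E'|).+2.
  by rewrite (cardsD1 a) aE (cardsD1 b (E :\ a)) bE'.
pose w (A : {set T}) := count (fun p => (p.1 \in A) && (p.2 \in A)) s.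
have wU y A : y \notin map fst s -> y \notin map snd s -> w (y |: A) = w A.
  move=> y1 y2; apply: eq_in_count => p ps; rewrite !inE.
  have -> : (p.1 == y) = false by apply: contraNF y1 => /eqP <-; apply: map_f.
  by have -> : (p.2 == y) = false by apply: contraNF y2 => /eqP <-; apply: map_f.
rewrite cardE !exprS.
have {IH} := IH E'; rewrite -/w => IH.
rewrite (eq_bigr (fun A => x ^+ w A * (3 + x))) => [|A]; last first.
  rewrite powersetE => sA.
  have aA : a \notin A.
    by apply: contraT; rewrite negbK => /(subsetP sA); rewrite !inE eqxx andbF.
  have bA : b \notin A.
    by apply: contraT; rewrite negbK => /(subsetP sA); rewrite !inE eqxx.
  rewrite -!/(w _) !wU // !inE !eqxx (negPf aA) (negPf bA) (negPf ab).
  rewrite [b == a]eq_sym (negPf ab) /= !add0n add1n exprS.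
  ring.
rewrite -mulr_suml.
transitivity ((\sum_(A in powerset E') x ^+ w A) * 4 ^+ size s * (4 * (3 + x))).
  by ring.
rewrite IH; first by ring.
  by rewrite cat_uniq us1 us us2.
move=> y; rewrite mem_cat !inE => ys.
have -> : y != b.
  by apply: contraTneq ys => ->; rewrite negb_or b1 b2.
have -> : y != a.
  by apply: contraTneq ys => ->; rewrite negb_or a1 a2.
by apply: sE; rewrite inE mem_cat inE; case/orP: ys => ->; rewrite ?orbT.
Qed.

(** Markov's inequality in counting form. *)
Lemma markov_card (R : realFieldType) (T : finType) (D P : pred T) (g : T -> R)
    (w : R) :
  (forall A, D A -> 0 <= g A) -> (forall A, D A -> P A -> w <= g A) ->
  #|[set A | D A && P A]|%:R * w <= \sum_(A | D A) g A.
Proof.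
move=> g0 gw; rewrite (bigID P) /= -[leLHS]addr0; apply: lerD; last first.
  by apply: sumr_ge0 => A /andP[/g0].
rewrite mulr_natl -sumr_const [leLHS](eq_bigl (fun A => D A && P A)) => [|A];
  last by rewrite inE.
by apply: ler_sum => A /andP[]; apply: gw.
Qed.

Definition pair_count (T : finType) (s : seq (T * T)) (A : {set T}) :=
  count (fun p => (p.1 \in A) && (p.2 \in A)) s.

(* Each pair lies inside a uniformly random subset of [E] with probability 1/4,
   independently of the others; these are the exponential moment bounds with
   base [y = 1 + e] for the two tails around the mean [size s / 4]. *)
Lemma chernoff_upper (R : realFieldType) (T : finType) (s : seq (T * T))
    (E : {set T}) (e : R) (t : nat) :
  uniq (map fst s ++ map snd s) -> {subset map fst s ++ map snd s <= E} ->
  0 <= e <= 1 ->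
  #|[set A in powerset E | (size s + t <= 4 * pair_count s A)%N]|%:R
    * (1 + e) ^+ t <= 2 ^+ #|E| * (1 + 5 * e ^+ 2) ^+ size s.
Proof.
move=> U sE /andP[e0 e1]; set m := size s; set y := 1 + e.
have y1 : 1 <= y by rewrite /y; lra.
have y0 : 0 < y by lra.
have K0 : 0 <= 1 + 5 * e ^+ 2 by have := sqr_ge0 e; lra.
have M := sum_powerset_pairs (y ^+ 4) U sE.
pose P (A : {set T}) := (m + t <= 4 * pair_count s A)%N.
have B : #|[set A in powerset E | P A]|%:R * y ^+ (m + t)
    <= \sum_(A in powerset E) (y ^+ 4) ^+ pair_count s A.
  apply: markov_card => A _; first by rewrite !exprn_ge0 // ltW.
  by move=> PA; rewrite -exprM ler_weXn2l.
have p0 : 0 < (4 * y) ^+ m by rewrite exprn_gt0 // mulr_gt0.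
rewrite -(ler_pM2r p0).
have -> : forall c : R, c * y ^+ t * (4 * y) ^+ m = c * y ^+ (m + t) * 4 ^+ m.
  by move=> c; rewrite exprD exprMn; ring.
(* Factor by factor this is [3 + y ^+ 4 <= (1 + 5 * e ^+ 2) * (4 * y)], where the constant and
   linear terms in [e] agree. *)
apply: le_trans (_ : 2 ^+ #|E| * (3 + y ^+ 4) ^+ m <= _); last first.
  rewrite -mulrA -exprMn ler_wpM2l ?exprn_ge0 //.
  apply: lerXn2r; rewrite ?nnegrE.
  - by rewrite addr_ge0 // exprn_ge0 // ltW.
  - by rewrite mulr_ge0 ?K0 // mulr_ge0 // ltW.
  rewrite /y; have : e ^+ 3 <= e ^+ 2 by rewrite ler_wiXn2l.
  have : e ^+ 4 <= e ^+ 2 by rewrite ler_wiXn2l.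
  have : 0 <= e ^+ 3 by rewrite exprn_ge0.
  have : 0 <= e ^+ 2 by rewrite exprn_ge0.
  have -> : 3 + (1 + e) ^+ 4 = 4 + 4 * e + 6 * e ^+ 2 + 4 * e ^+ 3 + e ^+ 4.
    by ring.
  have -> : (1 + 5 * e ^+ 2) * (4 * (1 + e))
    = 4 + 4 * e + 20 * e ^+ 2 + 20 * e ^+ 3 by ring.
  lra.
by rewrite /m -M ler_wpM2r ?exprn_ge0.
Qed.

Lemma chernoff_lower (R : realFieldType) (T : finType) (s : seq (T * T))
    (E : {set T}) (e : R) (t : nat) :
  uniq (map fst s ++ map snd s) -> {subset map fst s ++ map snd s <= E} ->
  0 <= e <= 1 ->
  #|[set A in powerset E | (4 * pair_count s A + t <= size s)%N]|%:R
    * (1 + e) ^+ t <= 2 ^+ #|E| * (1 + 5 * e ^+ 2) ^+ size s.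
Proof.
move=> U sE /andP[e0 e1]; set m := size s; set y := 1 + e.
have y1 : 1 <= y by rewrite /y; lra.
have y0 : 0 < y by lra.
have K0 : 0 <= 1 + 5 * e ^+ 2 by have := sqr_ge0 e; lra.
have M := sum_powerset_pairs (y ^- 4) U sE.
pose P (A : {set T}) := (4 * pair_count s A + t <= m)%N.
have B : #|[set A in powerset E | P A]|%:R * y ^+ t
    <= \sum_(A in powerset E) y ^+ m * (y ^- 4) ^+ pair_count s A.
  apply: markov_card => A _.
    by rewrite mulr_ge0 ?exprn_ge0 ?invr_ge0 ?exprn_ge0 // ltW.
  move=> PA; rewrite exprVn -exprM ler_pdivlMr ?exprn_gt0 // -exprD.
  by rewrite ler_weXn2l // addnC.
have p0 : 0 < (4 : R) ^+ m by rewrite exprn_gt0.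
rewrite -(ler_pM2r p0).
(* The same comparison for the base [y ^- 4]; after clearing [y ^+ 3] both sides again agree up to
   first order in [e]. *)
apply: le_trans (_ : 2 ^+ #|E| * (y * (3 + y ^- 4)) ^+ m <= _); last first.
  rewrite -mulrA -exprMn ler_wpM2l ?exprn_ge0 //.
  apply: lerXn2r; rewrite ?nnegrE.
  - by rewrite mulr_ge0 ?addr_ge0 ?invr_ge0 ?exprn_ge0 // ltW.
  - by rewrite mulr_ge0.
  have y3 : 0 < y ^+ 3 by rewrite exprn_gt0.
  have -> : y * (3 + y ^- 4) = (3 * y ^+ 4 + 1) / y ^+ 3.
    by field; rewrite lt0r_neq0.
  rewrite ler_pdivrMr // /y.
  have : e ^+ 3 <= e ^+ 2 by rewrite ler_wiXn2l.
  have : e ^+ 4 <= e ^+ 2 by rewrite ler_wiXn2l.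
  have : 0 <= e ^+ 2 by rewrite exprn_ge0.
  have : 0 <= e ^+ 3 by rewrite exprn_ge0.
  have : 0 <= e ^+ 4 by rewrite exprn_ge0.
  have : 0 <= e ^+ 5 by rewrite exprn_ge0.
  have -> : 3 * (1 + e) ^+ 4 + 1
    = 4 + 12 * e + 18 * e ^+ 2 + 12 * e ^+ 3 + 3 * e ^+ 4 by ring.
  have -> : (1 + 5 * e ^+ 2) * 4 * (1 + e) ^+ 3
    = 4 + 12 * e + 32 * e ^+ 2 + 64 * e ^+ 3 + 60 * e ^+ 4 + 20 * e ^+ 5.
    by ring.
  lra.
rewrite exprMn mulrCA /m -M mulrA ler_wpM2r ?exprn_ge0 //.
by rewrite mulr_sumr.
Qed.

End ProductWeights.

(** * Numerical constants in the tail bounds *)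

Section Constants.
Local Open Scope ring_scope.

Lemma bernoulli (R : realDomainType) (x : R) (n : nat) :
  -1 <= x -> 1 + n%:R * x <= (1 + x) ^+ n.
Proof.
move=> x1; elim: n => [|n IH]; first by rewrite expr0 mul0r addr0.
rewrite exprS; apply: le_trans (_ : (1 + x) * (1 + n%:R * x) <= _).
  rewrite -natr1; have : 0 <= n%:R * x ^+ 2 :> R by rewrite mulr_ge0 ?sqr_ge0.
  by rewrite expr2; lra.
by rewrite ler_wpM2l //; lra.
Qed.

(* The choice [e = 1 / (10 Q)] makes [(1 + 5 e^2)^Q] smaller than [1 + e] by a
   constant factor, which the exponent [t] amplifies. *)
Lemma tail_constant (R : realFieldType) (e : R) (Q n m t : nat) :
  (0 < Q)%N -> (m <= Q * t)%N -> (280 * Q * n <= t)%N -> e = (10 * Q)%:R^-1 ->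
  8 ^+ n * (1 + 5 * e ^+ 2) ^+ m <= (1 + e) ^+ t.
Proof.
move=> Q0 mQ nt eE; set q : R := (10 * Q)%:R in eE.
have q10 : 10 <= q by rewrite /q ler_nat; lia.
have e0 : 0 < e by rewrite eE invr_gt0; lra.
have qe : q * e = 1 by rewrite eE mulfV //; lra.
have qQ : q = 10 * Q%:R by rewrite /q natrM.
set K := 1 + 5 * e ^+ 2.
have K1 : 1 <= K by rewrite /K; have := sqr_ge0 e; lra.
have e10 : e * 10 <= 1.
  by apply: le_trans (_ : e * q <= _); rewrite ?ler_pM2l // mulrC qe.
(* [K * (1 - 5 * e ^+ 2) <= 1], and Bernoulli bounds [(1 - 5 * e ^+ 2) ^+ Q] below by [1 - 5 Q e^2],
   which is [1 - e / 2] because [10 Q e = 1]. *)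
have KQ : K ^+ Q * (1 - e / 2) <= 1.
  have KB : (K * (1 - 5 * e ^+ 2)) ^+ Q <= 1.
    apply: exprn_ile1; first by rewrite mulr_ge0 /K; nra.
    have -> : K * (1 - 5 * e ^+ 2) = 1 - 25 * e ^+ 4 by rewrite /K; ring.
    have := exprn_ge0 4 (ltW e0); lra.
  apply: le_trans KB; rewrite exprMn ler_wpM2l ?exprn_ge0 //; first lra.
  apply: le_trans (bernoulli _ _); last by nra.
  have -> : 1 - e / 2 = 1 - e * (q * e) / 2 by rewrite qe; ring.
  by rewrite qQ le_eqVlt; apply/orP; left; apply/eqP; field.
have step : (1 + e / 4) * K ^+ Q <= 1 + e.
  have h : 0 < 1 - e / 2 by lra.
  rewrite -(ler_pM2r h) -mulrA.
  apply: le_trans (_ : (1 + e / 4) * 1 <= _); first by rewrite ler_wpM2l //; lra.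
  nra.
apply: le_trans (_ : (1 + e / 4) ^+ t * K ^+ (Q * t) <= _); last first.
  rewrite exprM -exprMn; apply: lerXn2r => //; rewrite nnegrE; last lra.
  by rewrite mulr_ge0 ?exprn_ge0; lra.
apply: ler_pM; rewrite ?exprn_ge0 //; first lra; last exact: ler_weXn2l.
(* The constant 280: by Bernoulli, [280 * Q] factors already give [1 + 70 Q e = 8]. *)
apply: le_trans (_ : (1 + e / 4) ^+ (280 * Q * n) <= _); last first.
  by apply: ler_weXn2l => //; lra.
rewrite exprM; apply: lerXn2r; rewrite ?nnegrE ?exprn_ge0 //; first lra.
apply: le_trans (bernoulli _ _); last lra.
have -> : (280 * Q)%:R * (e / 4) = 7 * (q * e) by rewrite /q !natrM; field.
lra.
Qed.

End Constants.

(** * Codegrees *)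

Section Codegrees.
Variables (k n : nat).
Hypothesis k_gt1 : 1 < k.
Implicit Types (c : {ffun 'I_n -> bool}) (H : {set {set 'I_n}}) (e f : {set 'I_n}).
Implicit Types (u v w : 'I_n).

Definition free_edges c : {set {set 'I_n}} :=
  [set e : {set 'I_n} | (#|e| == k) && ~~ monochromatic c e].

(** The size of [f] is left to the uniformity of [H]. At [v = u] the value is the degree of [u],
    which matters when [candidate] colours [u] itself. *)
Definition codeg H u v : nat :=
  #|[set f : {set 'I_n} | [&& u \notin f, v \notin f, u |: f \in H & v |: f \in H]]|.

Definition candidate H u w : {ffun 'I_n -> bool} :=
  [ffun v => codeg H u w < codeg H u v].

Definition color_class c (b : bool) : {set 'I_n} := [set x | c x == b].

(** The sets [f] that can count towards [codeg H u v] when [c] is proper for [H]; for [u != v] each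
    does so with probability 1/4. *)
Definition links c u v : {set {set 'I_n}} :=
  [set f : {set 'I_n} |
    [&& u \notin f, v \notin f, u |: f \in free_edges c & v |: f \in free_edges c]].

Lemma monochromaticP c e :
  reflect (exists b, e \subset color_class c b) (monochromatic c e).
Proof.
apply: (iffP existsP) => -[b].
  move/forallP=> h; exists b; apply/subsetP => x xe; rewrite inE.
  exact: (implyP (h x)).
move/subsetP=> h; exists b; apply/forallP => x; apply/implyP => /h.
by rewrite inE.
Qed.

Lemma monochromaticU1 c u f :
  monochromatic c (u |: f) = (f \subset color_class c (c u)).
Proof.
apply/monochromaticP/idP => [[b]|s].
  by rewrite subUset sub1set inE => /andP[/eqP ->].
by exists (c u); rewrite subUset s sub1set inE eqxx.
Qed.

(** Identifies the hypergraphs for which [c] is proper with a full powerset, so that a uniform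
    choice among them picks the free edges independently. *)
Lemma proper_free_edges c H :
  uniform k H && proper_coloring H c = (H \subset free_edges c).
Proof.
apply/andP/subsetP => [[/forallP U /forallP P] e eH|h].
  by rewrite inE (implyP (U e)) // (implyP (P e)).
split; apply/forallP => e; apply/implyP => /h; rewrite inE => /andP[//].
Qed.

Lemma powerset_free_edges_le c :
  2 ^ #|free_edges c| <=
    #|[set H : {set {set 'I_n}} | uniform k H && two_colorable H]|.
Proof.
rewrite -card_powerset; apply: subset_leq_card; apply/subsetP => H.
rewrite powersetE inE -proper_free_edges => /andP[-> P] /=.
by apply/existsP; exists c.
Qed.

Let draws (X : {set 'I_n}) := [set f : {set 'I_n} | f \subset X & #|f| == k.-1].

(** Adding [u] to [f] gives a monochromatic set exactly when [f] lies in the class of [u], and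
    likewise for [v]; so only the sets inside one of the two classes are lost. *)
Lemma linksE c u v :
  links c u v = draws (~: [set u; v]) :\:
    (draws (color_class c (c u) :\: [set u; v])
       :|: draws (color_class c (c v) :\: [set u; v])).
Proof.
apply/setP => f; rewrite !inE !monochromaticU1 !cardsU1.
have dE : [disjoint f & [set u; v]] = (u \notin f) && (v \notin f).
  apply/pred0P/andP => [h|[uf vf] x]; last first.
    rewrite /= !inE; apply/negP => /andP[xf /orP[] /eqP xE].
      by rewrite -xE xf in uf.
    by rewrite -xE xf in vf.
  by split; apply/negP => xf; [have := h u|have := h v];
    rewrite /= !inE eqxx ?orbT xf.
have -> : f \subset ~: [set u; v] = (u \notin f) && (v \notin f).
  by rewrite -disjoints_subset.
rewrite !subsetD dE.
case: (boolP (u \in f)) => //= uf; first by rewrite andbF.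
case: (boolP (v \in f)) => //= vf; first by rewrite andbF.
rewrite !andbT !add1n -[in LHS](ltn_predK k_gt1) !eqSS.
by case: (#|f| == k.-1); rewrite ?andbF //= !andbT negb_or.
Qed.

Lemma card_draws_sub X : #|draws X| = 'C(#|X|, k.-1).
Proof. exact: cards_draws. Qed.

Lemma draws_sub (X Y : {set 'I_n}) : X \subset Y -> draws X \subset draws Y.
Proof.
move=> XY; apply/subsetP => f; rewrite !inE => /andP[fX ->].
by rewrite (subset_trans fX).
Qed.

Lemma card_set2C u v : u != v -> #|~: [set u; v]| = n - 2.
Proof. by move=> uv; rewrite cardsCs setCK card_ord cards2 uv. Qed.

Lemma card_links_le c u v : u != v -> #|links c u v| <= 'C(n - 2, k.-1).
Proof.
move=> uv; rewrite linksE -(card_set2C uv) -card_draws_sub.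
by rewrite subset_leq_card // subsetDl.
Qed.

(** Only sets inside the common class are lost. That class without [u] and [v] has two elements
    fewer, but the weaker count with one fewer is the one that cancels against [card_links_diff]. *)
Lemma card_links_same c u v : u != v -> c u = c v ->
  'C(n - 2, k.-1) <= #|links c u v| + 'C(#|color_class c (c u)|.-1, k.-1).
Proof.
move=> uv cuv; rewrite linksE -cuv setUid cardsD -(card_set2C uv).
rewrite addnC -card_draws_sub -leq_subLR leq_sub2l //.
apply: leq_trans (subset_leq_card (subsetIr _ _)) _.
rewrite card_draws_sub leq_bin2l //.
rewrite (cardsD1 u (color_class _ _)) inE eqxx add1n /=.
by rewrite subset_leq_card // setDS // sub1set !inE eqxx.
Qed.

(** The sets lost to the two classes form disjoint families, since a common member would be empty
    while [k - 1 > 0]; so both losses are counted in full. *)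
Lemma card_links_diff c u v : u != v -> c u != c v ->
  #|links c u v| + 'C(#|color_class c (c u)|.-1, k.-1)
    + 'C(#|color_class c (c v)|.-1, k.-1) <= 'C(n - 2, k.-1).
Proof.
move=> uv cuv; set A := color_class c (c u); set B := color_class c (c v).
have -> : #|A|.-1 = #|A :\: [set u; v]|.
  rewrite (cardsD1 u A) inE eqxx add1n /=; congr #|pred_of_set _|.
  apply/setP => x; rewrite !inE; case: (eqVneq x u) => //= _.
  by case: (eqVneq x v) => //= ->; rewrite eq_sym (negPf cuv).
have -> : #|B|.-1 = #|B :\: [set u; v]|.
  rewrite (cardsD1 v B) inE eqxx add1n /=; congr #|pred_of_set _|.
  apply/setP => x; rewrite !inE orbC; case: (eqVneq x v) => //= _.
  by case: (eqVneq x u) => //= ->; rewrite (negPf cuv).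
rewrite -!card_draws_sub -(card_set2C uv) -card_draws_sub linksE -/A -/B.
set DA := draws (A :\: _); set DB := draws (B :\: _); set D := draws (~: _).
have sA : DA \subset D by apply: draws_sub; rewrite setDE subsetIr.
have sB : DB \subset D by apply: draws_sub; rewrite setDE subsetIr.
have dis : DA :&: DB = set0.
  apply/setP => f; rewrite !inE; apply/negP => /andP[/andP[fA cf] /andP[fB _]].
  have : f \subset A :&: B.
    rewrite subsetI (subset_trans fA (subsetDl _ _)).
    exact: subset_trans fB (subsetDl _ _).
  have -> : A :&: B = set0.
    by apply/setP => x; rewrite !inE; case: (c x) (c u) (c v) cuv => -[] [].
  by rewrite subset0 => /eqP f0; move: cf; rewrite f0 cards0; lia.
rewrite cardsDS; last by rewrite subUset sA.
rewrite cardsU dis cards0 subn0 -addnA subnK //.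
rewrite -[#|DA| + _]subn0 -(cards0 {set 'I_n}) -dis -cardsU.
by rewrite subset_leq_card // subUset sA.
Qed.

Let pairs c u v := [seq (u |: f, v |: f) | f <- enum (links c u v)].

(** Every first component contains [u] and no second component does, so all edges involved are
    distinct and the pairs are independent. *)
Lemma pairs_uniq c u v : u != v ->
  uniq (map fst (pairs c u v) ++ map snd (pairs c u v)).
Proof.
move=> uv; rewrite cat_uniq /pairs -!map_comp.
rewrite !map_inj_in_uniq ?enum_uniq //=; first last.
- move=> f g; rewrite !mem_enum !inE => /and4P[uf _ _ _] /and4P[ug _ _ _] /= E.
  by rewrite -(setU1K uf) E setU1K.
- move=> f g; rewrite !mem_enum !inE => /and4P[_ vf _ _] /and4P[_ vg _ _] /= E.
  by rewrite -(setU1K vf) E setU1K.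
rewrite andbT; apply/hasP => -[x /mapP[f]]; rewrite mem_enum inE /=.
case/and4P=> uf _ _ _ -> /mapP[g _] /= /setP/(_ u).
by rewrite !inE eqxx (negPf uv) (negPf uf).
Qed.

Lemma pairs_sub c u v :
  {subset map fst (pairs c u v) ++ map snd (pairs c u v) <= free_edges c}.
Proof.
move=> x; rewrite mem_cat /pairs -!map_comp.
case/orP=> /mapP[f]; rewrite mem_enum inE => /and4P[_ _ uf vf] ->;
  by [exact: uf|exact: vf].
Qed.

(** All edges of [H] are free, so every [f] counted by [codeg] is a link. *)
Lemma codeg_pair_count c u v H : H \subset free_edges c ->
  codeg H u v = pair_count (pairs c u v) H.
Proof.
move=> /subsetP sH; rewrite /pair_count /pairs count_map -size_filter.
rewrite /codeg cardE; apply: perm_size; apply: uniq_perm.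
- exact: enum_uniq.
- by rewrite filter_uniq ?enum_uniq.
move=> f; rewrite mem_enum [in RHS]mem_filter mem_enum !inE /=.
apply/and4P/andP => [[-> -> uH vH]|[/andP[uH vH] /and4P[-> ->]]] //.
by rewrite uH vH; have := sH _ uH; have := sH _ vH; rewrite !inE => -> ->.
Qed.

Local Open Scope ring_scope.

Lemma codeg_upper_tail (R : realFieldType) c u v (x : R) (t : nat) :
  u != v -> 0 <= x <= 1 ->
  #|[set H in powerset (free_edges c) | (#|links c u v| + t <= 4 * codeg H u v)%N]|%:R
    * (1 + x) ^+ t <= 2 ^+ #|free_edges c| * (1 + 5 * x ^+ 2) ^+ #|links c u v|.
Proof.
move=> uv x01; have := chernoff_upper t (pairs_uniq c uv) (@pairs_sub c u v) x01.
rewrite size_map -cardE; congr (_%:R * _ <= _); apply: eq_card => H.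
by rewrite !inE; case: (boolP (_ \subset _)) => //= /codeg_pair_count ->.
Qed.

Lemma codeg_lower_tail (R : realFieldType) c u v (x : R) (t : nat) :
  u != v -> 0 <= x <= 1 ->
  #|[set H in powerset (free_edges c) | (4 * codeg H u v + t <= #|links c u v|)%N]|%:R
    * (1 + x) ^+ t <= 2 ^+ #|free_edges c| * (1 + 5 * x ^+ 2) ^+ #|links c u v|.
Proof.
move=> uv x01; have := chernoff_lower t (pairs_uniq c uv) (@pairs_sub c u v) x01.
rewrite size_map -cardE; congr (_%:R * _ <= _); apply: eq_card => H.
by rewrite !inE; case: (boolP (_ \subset _)) => //= /codeg_pair_count ->.
Qed.

End Codegrees.

(** * Hypergraphs on which the codegree candidates fail *)

Lemma leq_card_bigcup (I T : finType) (P : pred I) (B : I -> {set T}) :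
  #|\bigcup_(i | P i) B i| <= \sum_(i | P i) #|B i|.
Proof.
elim/big_rec2: _ => [|i x A _ h]; first by rewrite cards0.
by rewrite (leq_trans (leq_card_setU _ _)) // leq_add2l.
Qed.

Lemma proper_coloring_empty (n : nat) (c : {ffun 'I_n -> bool}) :
  proper_coloring set0 c.
Proof. by apply/forallP => e; rewrite inE. Qed.

Lemma proper_coloring_xor (n : nat) (H : {set {set 'I_n}})
    (c c' : {ffun 'I_n -> bool}) (b : bool) :
  (forall v, c' v = c v (+) b) -> proper_coloring H c -> proper_coloring H c'.
Proof.
move=> E /forallP P; apply/forallP => e; apply/implyP => eH.
apply: contra (implyP (P e) eH) => /existsP[b' /forallP h].
apply/existsP; exists (b' (+) b); apply/forallP => v; apply/implyP => ve.
by have := implyP (h v) ve; rewrite E => /eqP <-; rewrite addbK.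
Qed.

(** Take for [w] the vertex of the opposite class with the largest codegree: the candidate is then
    true exactly on the class of [u], hence equals [c] up to a swap. The vertex [u], not covered by
    the separation hypothesis, needs its own argument. *)
Lemma candidate_proper (n : nat) (H : {set {set 'I_n}}) (c : {ffun 'I_n -> bool})
    (u v0 : 'I_n) :
  proper_coloring H c -> c v0 != c u ->
  (forall v v', v != u -> c v = c u -> c v' != c u -> codeg H u v' < codeg H u v) ->
  exists w, proper_coloring H (candidate H u w).
Proof.
move=> P cv0 sep.
have [->|[e eH]] := set_0Vmem H; first by exists u; apply: proper_coloring_empty.
case: (@arg_maxnP _ v0 (fun v => c v != c u) (codeg H u) cv0) => w cw wmax.
exists w; apply: (@proper_coloring_xor _ _ c _ (~~ c u)) (P) => v.
rewrite ffunE; have [cv|cv] := eqVneq (c v) (c u); last first.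
  by rewrite ltnNge (wmax v cv : _ <= _); case: (c v) (c u) cv => -[].
rewrite cv addbN addbb.
have [->|vu] := eqVneq v u; last exact: sep.
(* The degree of [u] is at least its codegree with any other vertex of its class. *)
have [/existsP[x /andP[xu /eqP cx]]|] := boolP [exists x, (x != u) && (c x == c u)].
  apply: leq_trans (sep x w xu cx cw) _; apply: subset_leq_card.
  by apply/subsetP => f; rewrite !inE => /and4P[-> _ ->].
(* If [u] is alone in its class, every edge contains [u]; hence its codegree with [w] vanishes,
   while the edge [e] makes its degree positive. *)
rewrite negb_exists => /forallP alone.
have col x : x != u -> c x = ~~ c u.
  by move=> xu; have := alone x; rewrite xu /=; case: (c x) (c u) => -[].
have H_u g : g \in H -> u \in g.
  move=> gH; apply: contraT => ug.
  have /negP[] := implyP (forallP P g) gH.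
  apply/monochromaticP; exists (~~ c u); apply/subsetP => x xg; rewrite inE col //.
  by apply: contraNneq ug => <-.
have wu : w != u by apply: contraNneq cw => ->.
have -> : codeg H u w = 0.
  apply/eqP; rewrite cards_eq0; apply/eqP/setP => f; rewrite !inE.
  apply/negP => /and4P[uf _ _ /H_u]; rewrite !inE eq_sym (negPf wu) /=.
  exact/negP.
apply/card_gt0P; exists (e :\ u); rewrite !inE eqxx /=.
by rewrite setD1K ?H_u // eH.
Qed.

Lemma ffact_leq_exp (n m : nat) : n ^_ m <= n ^ m.
Proof.
elim: m n => [//|m IH] n; rewrite ffactnS expnS leq_mul2l.
rewrite (leq_trans (IH _)) ?orbT //.
by case: m {IH} => // m; rewrite leq_exp2r ?leq_pred.
Qed.

Lemma exp_leq_ffact (n m : nat) : (n.+1 - m) ^ m <= n ^_ m.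
Proof.
elim: m n => [//|m IH] [|n]; first by rewrite subSS sub0n exp0n.
by rewrite ffactSS subSS expnS leq_mul // leq_subr.
Qed.

Lemma bin_leq_exp (n m : nat) : 'C(n, m) <= n ^ m.
Proof.
apply: leq_trans (ffact_leq_exp n m); rewrite -bin_ffact leq_pmulr //.
exact: fact_gt0.
Qed.

(** Every factor of the falling factorial of [b - 1] is at least [b - (k - 1)], hence at least
    [n / 4]. *)
Lemma exp_leq_bin (k n b : nat) : 0 < k -> 4 * k <= n -> n <= 2 * b ->
  n ^ k.-1 <= 4 ^ k.-1 * k.-1`! * 'C(b.-1, k.-1).
Proof.
move=> k0 kn nb; rewrite -mulnA [k.-1`! * _]mulnC bin_ffact.
apply: leq_trans (_ : (4 * (b - k.-1)) ^ k.-1 <= _).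
  have : n <= 4 * (b - k.-1) by lia.
  by case: (k.-1) => // j h; rewrite leq_exp2r.
rewrite expnMn leq_mul2l; apply/orP; right.
by have := exp_leq_ffact b.-1 k.-1; rewrite prednK //; lia.
Qed.

(** The [Q] of [tail_constant]. The factor 3 pays for the rounding in [t]: a binomial coefficient
    [C >= 2] is at most [3 * C./2]. *)
Definition tail_ratio (k : nat) : nat := 3 * (4 ^ k.-1 * k.-1`!).

Definition bad (n : nat) (H : {set {set 'I_n}}) : bool :=
  [forall u, forall w, ~~ proper_coloring H (candidate H u w)].

Section FewBad.
Variables (k n : nat).
Hypothesis k_gt2 : 2 < k.
Hypothesis n_large : 280 * tail_ratio k ^ 2 + 4 * k <= n.
Implicit Types (c : {ffun 'I_n -> bool}) (H : {set {set 'I_n}}).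

Let k_gt1 : 1 < k := ltnW k_gt2.

(** Common to both tails, whence the abstract [P]: there are at most [n ^ k.-1] links and [t] has
    the same order, so [tail_constant] turns the exponential bound into a factor [8 ^ n]. *)
Lemma tail_cards (c : {ffun 'I_n -> bool}) (u v : 'I_n) (b t : nat)
    (P : pred {set {set 'I_n}}) :
  u != v -> n <= 2 * b -> t = 'C(b.-1, k.-1)./2 ->
  (forall x : rat, 0 <= x <= 1 ->
    #|[set H in powerset (free_edges k c) | P H]|%:R * (1 + x) ^+ t
      <= 2 ^+ #|free_edges k c| * (1 + 5 * x ^+ 2) ^+ #|links k c u v|)%R ->
  #|[set H in powerset (free_edges k c) | P H]| * 8 ^ n <= 2 ^ #|free_edges k c|.
Proof.
move=> uv nb tE tail; set N := #|[set H in _ | _]| in tail *.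
have nl := n_large; set Q := tail_ratio k in nl.
have Q0 : 0 < Q by rewrite /Q /tail_ratio !muln_gt0 expn_gt0 fact_gt0.
have nkb : n ^ k.-1 <= 4 ^ k.-1 * k.-1`! * 'C(b.-1, k.-1).
  by apply: exp_leq_bin; lia.
(* This is where [k >= 3] enters: the deviation grows at least like [n ^ 2] and so beats any
   multiple of [n]. *)
have kn : n ^ 2 <= n ^ k.-1 by rewrite leq_pexp2l; lia.
have n0 : 280 <= n by nia.
have nQt : n ^ k.-1 <= Q * t.
  have QE : Q = 3 * (4 ^ k.-1 * k.-1`!) by [].
  move: nkb QE; set z := _ * _`! => nkb QE.
  have C2 : 2 <= 'C(b.-1, k.-1).
    rewrite ltnNge; apply/negP => C1.
    have zn : n ^ 2 <= z by apply: leq_trans kn (leq_trans nkb _); nia.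
    by nia.
  have Ct : 'C(b.-1, k.-1) <= 3 * t by rewrite tE; lia.
  by apply: leq_trans nkb _; rewrite QE; nia.
pose x : rat := ((10 * Q)%:R^-1)%R.
have x01 : (0 <= x <= 1)%R.
  by rewrite /x invr_ge0 ler0n invf_le1 ?ltr0n ?ler1n; lia.
have C : (8 ^+ n * (1 + 5 * x ^+ 2) ^+ #|links k c u v| <= (1 + x) ^+ t)%R.
  apply: (@tail_constant _ _ Q) => //.
    apply: leq_trans (card_links_le k_gt1 c uv) _.
    apply: leq_trans (bin_leq_exp _ _) _; apply: leq_trans _ nQt.
    by rewrite leq_exp2r; lia.
  (* From [n ^ 2 <= Q * t] and [280 * Q ^ 2 <= n] follows [280 * Q * n <= t]; hence the square in
     [n_large]. *)
  by move: (leq_trans kn nQt); nia.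
have := tail _ x01; set K := (_ ^+ #|links k c u v|)%R in C * => TL.
have K0 : (0 < K)%R.
  by rewrite exprn_gt0 // ltr_wpDr // mulr_ge0 // sqr_ge0.
rewrite -(ler_nat rat) natrM !natrX -(ler_pM2r K0); apply: le_trans TL.
by rewrite -mulrA ler_wpM2l // ler0n.
Qed.

Lemma bad_card_coloring c :
  #|[set H in powerset (free_edges k c) | bad H]| * 8 ^ n
    <= n * 2 ^ #|free_edges k c|.
Proof.
set X := [set H in _ | _].
have n0 : 0 < n by lia.
pose x0 : 'I_n := Ordinal n0.
(* A constant colouring is proper only for the empty hypergraph, for which every candidate is
   proper. *)
have [/forallP cst|] := boolP [forall x, c x == c x0].
  suff -> : X = set0 by rewrite cards0.
  apply/setP => H; rewrite !inE -proper_free_edges; apply/negP.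
  case/andP=> /andP[_ P] /forallP/(_ x0)/forallP/(_ x0)/negP[].
  have [->|[e eH]] := set_0Vmem H; first exact: proper_coloring_empty.
  have /negP[] := implyP (forallP P e) eH.
  by apply/monochromaticP; exists (c x0); apply/subsetP => x _; rewrite inE.
rewrite negb_forall => /existsP[x1 cx1].
have [u [v0 [cv0 small]]] : exists u v0 : 'I_n,
    c v0 != c u /\ 2 * #|color_class c (c u)| <= n.
  have nE : #|color_class c (c x0)| + #|color_class c (c x1)| = n.
    rewrite -[RHS]card_ord -(cardsC (color_class c (c x0))); congr (_ + _).
    apply: eq_card => x; rewrite !inE.
    by case: (c x) (c x0) (c x1) cx1 => -[] [].
  have [le|lt] := leqP #|color_class c (c x0)| #|color_class c (c x1)|.
    by exists x0, x1; split=> //; lia.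
  by exists x1, x0; split; [rewrite eq_sym|lia].
pose b := #|color_class c (~~ c u)|.
have bE : #|color_class c (c u)| + b = n.
  rewrite -[RHS]card_ord -(cardsC (color_class c (c u))); congr (_ + _).
  by apply: eq_card => x; rewrite !inE; case: (c x) (c u) => -[].
(* A deviation of [t] on each side fits into the gap ['C(b.-1, k.-1)] between the link counts.
   Codegrees appear multiplied by 4 because their mean is a quarter of the link count. *)
pose t := 'C(b.-1, k.-1)./2.
have nb : n <= 2 * b by lia.
pose P v H := if c v == c u then 4 * codeg H u v + t <= #|links k c u v|
  else #|links k c u v| + t <= 4 * codeg H u v.
pose B v := [set H in powerset (free_edges k c) | P v H].
have cardB v : v != u -> #|B v| * 8 ^ n <= 2 ^ #|free_edges k c|.
  move=> vu; apply: (@tail_cards c u v b t) => //; first by rewrite eq_sym.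
  move=> x x01; rewrite /P; case: (c v == c u).
    by apply: codeg_lower_tail; rewrite // eq_sym.
  by apply: codeg_upper_tail; rewrite // eq_sym.
(* If no tail event occurs, the codegrees with [u] separate the two classes, and [candidate_proper]
   contradicts [bad H]. *)
have sX : X \subset \bigcup_(v | v != u) B v.
  apply/subsetP => H; rewrite !inE => /andP[sH badH].
  apply/bigcupP; apply: contrapT => nB.
  have {}nB v : v != u -> ~~ P v H.
    by move=> vu; apply/negP => PH; apply: nB; exists v; rewrite // !inE sH.
  have pc : proper_coloring H c.
    by move: sH; rewrite -proper_free_edges => /andP[].
  have [] := @candidate_proper n H c u v0 pc cv0; last first.
    by move=> w pw; have /negP := forallP (forallP badH u) w.
  move=> v v' vu cv cv'.
  have v'u : v' != u by apply: contraNneq cv' => ->.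
  have := nB v vu; have := nB v' v'u; rewrite /P cv eqxx (negPf cv').
  have := card_links_same k_gt1 (_ : u != v) (esym cv).
  rewrite [u == v]eq_sym vu => /(_ isT) h1.
  have := card_links_diff k_gt1 (_ : u != v') (_ : c u != c v').
  rewrite [u == v']eq_sym [c u == _]eq_sym v'u cv' => /(_ isT isT).
  have -> : c v' = ~~ c u by case: (c v') (c u) cv' => -[].
  have h2 : 2 * t <= 'C(b.-1, k.-1) 
    by rewrite /t mul2n -[leqRHS]odd_double_half leq_addl.
  rewrite -/b /=; move: h1 h2.
  have arith (ms md cs cd s A M C : nat) : M <= ms + A -> 2 * s <= C ->
    md + A + C <= M -> ~~ (md + s <= 4 * cd) -> ~~ (4 * cs + s <= ms) -> cd < cs.
    by clear; lia.
  exact: arith.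
apply: leq_trans (_ : \sum_(v | v != u) #|B v| * 8 ^ n <= _).
  rewrite -big_distrl leq_mul2r; apply/orP; right.
  by apply: leq_trans (subset_leq_card sX) (leq_card_bigcup _ _).
apply: leq_trans (_ : \sum_(v : 'I_n) 2 ^ #|free_edges k c| <= _); last first.
  by rewrite sum_nat_const card_ord.
rewrite [X in _ <= X](bigID (fun v => v != u)) /=.
by apply: leq_trans (leq_addr _ _); apply: leq_sum.
Qed.

Lemma bad_card :
  #|[set H : {set {set 'I_n}} | [&& uniform k H, two_colorable H & bad H]]| * 4 ^ n
    <= n * #|[set H : {set {set 'I_n}} | uniform k H && two_colorable H]|.
Proof.
set N := #|[set H | uniform k H && two_colorable H]|.
set X := [set H | _].
rewrite -(leq_pmul2l (_ : 0 < 2 ^ n)) ?expn_gt0 //.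
(* Of the factor [8 ^ n], the union bound over colourings uses [2 ^ n]; the remaining [4 ^ n] will
   pay for the exhaustive search. *)
have -> : 2 ^ n * (#|X| * 4 ^ n) = #|X| * 8 ^ n.
  by rewrite mulnCA -expnMn.
pose B c := [set H in powerset (free_edges k c) | bad H].
have sX : X \subset \bigcup_c B c.
  apply/subsetP => H; rewrite inE => /and3P[U /existsP[c P] b].
  by apply/bigcupP; exists c => //; rewrite !inE -proper_free_edges U P b.
apply: leq_trans (_ : (\sum_c #|B c|) * 8 ^ n <= _).
  rewrite leq_mul2r; apply/orP; right.
  by apply: leq_trans (subset_leq_card sX) (leq_card_bigcup _ _).
rewrite big_distrl /=.
apply: leq_trans (_ : \sum_(c : {ffun 'I_n -> bool}) n * N <= _); last first.
  by rewrite sum_nat_const card_ffun card_bool card_ord.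
apply: leq_sum => c _; apply: leq_trans (bad_card_coloring c) _.
by rewrite leq_mul2l powerset_free_edges_le orbT.
Qed.

End FewBad.

(** * Loop programs *)

Lemma updE (m : memory) a x : upd m a x a = x.
Proof. by rewrite /upd eqxx. Qed.

Lemma upd_neq (m : memory) a b x : b != a -> upd m a x b = m b.
Proof. by rewrite /upd => /negPf ->. Qed.

(* Cells 0, ..., 5 are read-only and hold n, 1, 0, the address of the colour
   array, k and the address of the tuple buffer; the colour array lies above all
   the other cells in use. *)
Definition tuple_base := 20.
Definition color_base (k : nat) := tuple_base + k.

Record ctx (k n : nat) (m : memory) : Prop := Ctx {
  ctx0 : m 0 = n; ctx1 : m 1 = 1; ctx2 : m 2 = 0; ctx3 : m 3 = color_base k;
  ctx4 : m 4 = k; ctx5 : m 5 = tuple_base }.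

Lemma ctx_eq (k n : nat) (m m' : memory) :
  (forall a, a < 6 -> m' a = m a) -> ctx k n m -> ctx k n m'.
Proof. by move=> E [? ? ? ? ? ?]; split; rewrite E. Qed.

(* Programs without unbounded loops.  [CPut v y] writes the colour of vertex
   [m[v]], and [CFor x p] runs [p] for x = n-1, ..., 0. *)
Inductive code : Type :=
| CConst (x c : nat)
| CAdd (x y z : nat)
| CMonus (x y z : nat)
| CFetch (x y : nat)
| CQuery (x y : nat)
| CPut (v y : nat)
| CSeq (p q : code)
| CIf (x : nat) (p q : code)
| CFor (x : nat) (p : code).

Definition address_cell := 6.

(** Relies on the constants in cells 0 to 3: [Add x 0 2] loads [n] into [x], [Monus x x 1]
    decrements, and cell 3 is the start of the colour array. *)
Fixpoint compile (p : code) : program :=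
  match p with
  | CConst x c => Const x c
  | CAdd x y z => Add x y z
  | CMonus x y z => Monus x y z
  | CFetch x y => Fetch x y
  | CQuery x y => Query x y
  | CPut v y => Seq (Add address_cell 3 v) (Store address_cell y)
  | CSeq p q => Seq (compile p) (compile q)
  | CIf x p q => If x (compile p) (compile q)
  | CFor x p => Seq (Add x 0 2) (While x (Seq (Monus x x 1) (compile p)))
  end.

Fixpoint writes (p : code) : seq nat :=
  match p with
  | CConst x _ | CAdd x _ _ | CMonus x _ _ | CFetch x _ | CQuery x _ => [:: x]
  | CPut _ _ => [:: address_cell]
  | CSeq p q | CIf _ p q => writes p ++ writes q
  | CFor x p => x :: writes p
  end.

Fixpoint put_free (p : code) : bool :=
  match p with
  | CPut _ _ => false
  | CSeq p q | CIf _ p q => put_free p && put_free q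
  | CFor _ p => put_free p
  | _ => true
  end.

Fixpoint loops_ok (p : code) : bool :=
  match p with
  | CSeq p q | CIf _ p q => loops_ok p && loops_ok q
  | CFor x p => (x \notin writes p) && loops_ok p
  | _ => true
  end.

Definition well_formed (k : nat) (p : code) : bool :=
  loops_ok p && all (fun x => 5 < x < color_base k) (writes p).

(** An upper bound on the steps. Each loop pass adds three (test, sequencing, decrement), and three
    more go to sequencing, initialisation and the final test; both branches of a conditional are
    charged. *)
Fixpoint cost (n : nat) (p : code) : nat :=
  match p with
  | CPut _ _ => 3
  | CSeq p q | CIf _ p q => (cost n p + cost n q).+1
  | CFor _ p => n * (cost n p + 3) + 3
  | _ => 1
  end.

Fixpoint code_size (p : code) : nat :=
  match p with
  | CSeq p q | CIf _ p q => (code_size p + code_size q).+1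
  | CFor _ p => code_size p + 6
  | _ => 3
  end.

Fixpoint loop_depth (p : code) : nat :=
  match p with
  | CSeq p q | CIf _ p q => maxn (loop_depth p) (loop_depth q)
  | CFor _ p => (loop_depth p).+1
  | _ => 0
  end.

(** The degree of the polynomial is the nesting depth of loops; [code_size] is weighted so that the
    induction absorbs the loop overhead. *)
Lemma cost_leq (n : nat) (p : code) :
  cost n p <= code_size p * n.+1 ^ loop_depth p.
Proof.
have X d : 0 < n.+1 ^ d by rewrite expn_gt0.
elim: p => //= [p IHp q IHq|_ p IHp q IHq|_ p IHp].
1,2: have := leq_pexp2l (ltn0Sn n) (leq_maxl (loop_depth p) (loop_depth q));
  have := leq_pexp2l (ltn0Sn n) (leq_maxr (loop_depth p) (loop_depth q));
  have := X (maxn (loop_depth p) (loop_depth q)); nia.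
by rewrite expnS; have := X (loop_depth p); nia.
Qed.

Lemma well_formedP (k : nat) (p : code) a :
  well_formed k p -> a \in writes p -> 5 < a < color_base k.
Proof. by case/andP=> _ /allP h /h. Qed.

Lemma well_formed2 (k : nat) (p q : code) :
  well_formed k (CSeq p q) = well_formed k p && well_formed k q.
Proof. by rewrite /well_formed /= all_cat andbACA. Qed.

Lemma well_formed_if (k x : nat) (p q : code) :
  well_formed k (CIf x p q) = well_formed k p && well_formed k q.
Proof. exact: well_formed2. Qed.

Lemma well_formed_for (k x : nat) (p : code) :
  well_formed k (CFor x p) =
    [&& x \notin writes p, 5 < x < color_base k & well_formed k p].
Proof. by rewrite /well_formed /= -!andbA; do !bool_congr. Qed.

Fixpoint down_loop (T : Type) (f : nat -> T -> T) (i : nat) (x : T) : T :=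
  if i is i'.+1 then down_loop f i' (f i' x) else x.

(** * Denotational semantics and its agreement with execution *)

Section Semantics.
Variables (k n : nat) (H : {set {set 'I_n}}).

(** Separates correctness from step counting. A loop resets its counter before each pass, which
    agrees with the compiled decrement because a well-formed body never writes the counter. *)
Fixpoint den (p : code) (m : memory) : memory :=
  match p with
  | CConst x c => upd m x c
  | CAdd x y z => upd m x (m y + m z)
  | CMonus x y z => upd m x (m y - m z)
  | CFetch x y => upd m x (m (m y))
  | CQuery x y => upd m x (edge_oracle H [seq m (m y + i) | i <- iota 0 k])
  | CPut v y => let m' := upd m address_cell (m 3 + m v) in
      upd m' (m 3 + m v) (m' y)
  | CSeq p q => den q (den p m)
  | CIf x p q => if m x != 0 then den p m else den q m
  | CFor x p =>
      down_loop (fun i m => den p (upd m x i)) (m 0) (upd m x (m 0))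
  end.

(** [J i] is the invariant once the counter values [n - 1] down to [i] have been processed. *)
Lemma den_for_ind (J : nat -> memory -> Prop) (x : nat) (p : code) (m : memory) :
  m 0 = n -> J n (upd m x n) ->
  (forall i m', i < n -> J i.+1 m' -> J i (den p (upd m' x i))) ->
  J 0 (den (CFor x p) m).
Proof.
move=> m0 Jn IH; rewrite /= m0.
suff loop i m1 : i <= n -> J i m1 ->
  J 0 (down_loop (fun i m => den p (upd m x i)) i m1) by exact: loop.
elim: i m1 => [//|i IHi] m1 lt J1; apply: IHi; [exact: ltnW|exact: IH].
Qed.

(** [ctx] fixes cell 3, so [CPut] stores its colour inside the array. [writes] omits that cell,
    whence the alternative: stay below the array or use a [put_free] code. [ctx] itself survives
    because well-formed codes leave cells 0 to 5 alone. *)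
Lemma den_frame (p : code) (m : memory) (a : nat) :
  well_formed k p -> ctx k n m -> (a < color_base k) || put_free p ->
  a \notin writes p -> den p m a = m a.
Proof.
have ctxU (q : code) m' : well_formed k q -> ctx k n m' ->
    (forall b, b < color_base k -> b \notin writes q -> den q m' b = m' b) ->
    ctx k n (den q m').
  move=> wq cm fr; apply: ctx_eq cm => b b6; apply: fr.
    by apply: ltn_trans b6 _; rewrite /color_base.
  by apply/negP => /(well_formedP wq); lia.
elim: p m a => [x c|x y z|x y z|x y|x y|v y|p IHp q IHq|x p IHp q IHq|x p IHp] m a;
  rewrite ?inE.
1,2,3,4,5: by move=> _ _ _ ax; rewrite /= upd_neq.
- move=> _ cm; rewrite orbF => aB ax; rewrite /= !upd_neq //.
  by rewrite (ctx3 cm); apply/eqP; move: aB; lia.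
- rewrite well_formed2 mem_cat negb_or => /andP[wp wq] cm ok /andP[ap aq] /=.
  have cp : ctx k n (den p m).
    by apply: ctxU => // b bB bp; apply: IHp; rewrite ?bB.
  have [okp okq] : (a < color_base k) || put_free p /\ (a < color_base k) || put_free q.
    by move: ok => /= /orP[->|/andP[-> ->]]; rewrite ?orbT.
  by rewrite (IHq _ a wq cp okq aq) (IHp _ a wp cm okp ap).
- rewrite well_formed_if mem_cat negb_or.
  move=> /andP[wp wq] cm ok /andP[ap aq] /=.
  have [okp okq] : (a < color_base k) || put_free p /\ (a < color_base k) || put_free q.
    by move: ok => /= /orP[->|/andP[-> ->]]; rewrite ?orbT.
  by case: ifP => _; [apply: IHp|apply: IHq].
- rewrite well_formed_for negb_or => /and3P[xp /andP[x5 xB] wp] cm ok /andP[ax ap].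
  suff [] : den (CFor x p) m a = m a /\ ctx k n (den (CFor x p) m) by [].
  have ctxx m' i : ctx k n m' -> ctx k n (upd m' x i).
    by apply: ctx_eq => b b6; rewrite upd_neq //; lia.
  apply: (@den_for_ind (fun _ m' => m' a = m a /\ ctx k n m') x p m (ctx0 cm)).
    by rewrite upd_neq //; split=> //; apply: ctxx.
  move=> i m' _ [m'a cm']; split.
    by rewrite IHp ?upd_neq //; apply: ctxx.
  apply: ctxU => //; first exact: ctxx.
  by move=> b bB bp; apply: IHp; rewrite ?bB //; apply: ctxx.
Qed.

Lemma den_ctx (p : code) (m : memory) :
  well_formed k p -> ctx k n m -> ctx k n (den p m).
Proof.
move=> wp cm; apply: (ctx_eq _ cm) => a a6; apply: den_frame => //.
  by apply/orP; left; apply: ltn_trans a6 _; rewrite /color_base.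
by apply/negP => /(well_formedP wp); lia.
Qed.

(** Quantifying over the remaining stack [K] makes runs composable. *)
Definition eval (p : program) (m m' : memory) (t : nat) : Prop :=
  forall K, iter t (step k H) (p :: K, m) = (K, m').

Lemma eval_seq p q m m1 m2 t1 t2 :
  eval p m m1 t1 -> eval q m1 m2 t2 -> eval (Seq p q) m m2 (t1 + t2).+1.
Proof. by move=> E1 E2 K; rewrite iterSr addnC iterD /= E1 E2. Qed.

Lemma eval_while_false x p m : m x = 0 -> eval (While x p) m m 1.
Proof. by move=> x0 K; rewrite /= x0. Qed.

Lemma eval_while_true x p m m1 m2 t1 t2 : m x != 0 ->
  eval p m m1 t1 -> eval (While x p) m1 m2 t2 ->
  eval (While x p) m m2 (t1 + t2).+1.
Proof. by move=> x0 E1 E2 K; rewrite iterSr addnC iterD /= x0 E1 E2. Qed.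

Lemma eval_compile (p : code) (m : memory) :
  well_formed k p -> ctx k n m ->
  exists2 t, t <= cost n p & eval (compile p) m (den p m) t.
Proof.
elim: p m => [x c|x y z|x y z|x y|x y|v y|p IHp q IHq|x p IHp q IHq|x p IHp] m.
1,2,3,4,5: by exists 1.
- by exists 3.
- rewrite well_formed2 => /andP[wp wq] cm /=.
  have [t1 le1 E1] := IHp _ wp cm.
  have [t2 le2 E2] := IHq _ wq (den_ctx wp cm).
  by exists (t1 + t2).+1; [rewrite ltnS leq_add|apply: eval_seq E1 E2].
- rewrite well_formed_if => /andP[wp wq] cm /=.
  have [t1 le1 E1] := IHp _ wp cm; have [t2 le2 E2] := IHq _ wq cm.
  case: ifP => mx.
    by exists t1.+1 => [|K]; [lia|rewrite iterSr /= mx E1].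
  by exists t2.+1 => [|K]; [lia|rewrite iterSr /= mx E2].
- rewrite well_formed_for => /and3P[xp /andP[x5 xB] wp] cm.
  have ctxx m' i : ctx k n m' -> ctx k n (upd m' x i).
    by apply: ctx_eq => b b6; rewrite upd_neq //; lia.
  (* The cell [x] holds [i] when tested; for positive [i] the decrement yields the value [down_loop]
     hands to the body, and the body preserves it until the next test. *)
  have loop i m1 : ctx k n m1 -> m1 x = i -> exists2 t, t <= i * (cost n p + 3) + 1 &
      eval (While x (Seq (Monus x x 1) (compile p))) m1
        (down_loop (fun i m => den p (upd m x i)) i m1) t.
    elim: i m1 => [|i IHi] m1 cm1 m1x.
      by exists 1; [|apply: eval_while_false].
    have cx := ctxx _ i cm1.
    have [t1 le1 E1] := IHp _ wp cx.
    have [|t2 le2 E2] := IHi _ (den_ctx wp cx).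
      by rewrite den_frame ?updE ?xB.
    exists ((1 + t1).+1 + t2).+1; first by move: le1 le2; lia.
    apply: eval_while_true E2; first by rewrite m1x.
    apply: eval_seq E1 => K /=.
    by rewrite m1x (ctx1 cm1) subSS subn0.
  have [|t le E] := loop n _ (ctxx m n cm); first by rewrite updE.
  exists (1 + t).+1; first by move: le => /=; lia.
  rewrite /= (ctx0 cm); apply: eval_seq E => K /=.
  by rewrite (ctx0 cm) (ctx2 cm) addn0.
Qed.

End Semantics.

(** * The codegree search *)

Fixpoint all_tuples (n j : nat) : seq (seq nat) :=
  if j is j'.+1 then [seq i :: l | i <- iota 0 n, l <- all_tuples n j']
  else [:: [::]].

Lemma mem_all_tuples (n j : nat) (l : seq nat) :
  (l \in all_tuples n j) = (size l == j) && all (ltn^~ n) l.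
Proof.
elim: j l => [|j IH] l; first by case: l.
apply/allpairsP/andP => [[[i l'] /= [+ + ->]]|].
  by rewrite mem_iota IH /= => -> /andP[/eqP -> ->].
case: l => [[]//|i l] /= [/eqP[sl]] /andP[lt al].
by exists (i, l); rewrite /= mem_iota IH sl eqxx.
Qed.

Lemma all_tuples_uniq (n j : nat) : uniq (all_tuples n j).
Proof.
elim: j => [//|j IH]; apply: allpairs_uniq => //; first exact: iota_uniq.
by move=> [a b] [c d] _ _ [-> ->].
Qed.

Notation "p ;; q" := (CSeq p q) (at level 70, right associativity).

Definition skip : code := CConst address_cell 0.

Definition nest (s : seq nat) (p : code) : code := foldr CFor p s.

Lemma writes_nest s p : writes (nest s p) = s ++ writes p.
Proof. by elim: s => //= x s ->. Qed.

Lemma put_free_nest s p : put_free (nest s p) = put_free p.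
Proof. by elim: s. Qed.

Lemma well_formed_nest k s p :
  well_formed k (nest s p) =
    [&& uniq s, all (fun x => x \notin writes p) s,
      all (fun x => 5 < x < color_base k) s & well_formed k p].
Proof.
elim: s => [//|x s IH]; rewrite [nest _ _]/= well_formed_for IH writes_nest.
rewrite mem_cat negb_or /= -!andbA; do !bool_congr.
Qed.

(** The cells of the tuple buffer double as loop counters, so each pass queries the tuple of current
    counter values. For codegrees the first cell is filled by hand and only the others are looped
    over. *)
Definition tuple_cells (k : nat) : seq nat := [seq tuple_base + i | i <- iota 0 k].
Definition tail_cells (k : nat) : seq nat := [seq tuple_base + i | i <- iota 1 k.-1].

Lemma mem_tuple_cells k a :
  (a \in tuple_cells k) = (tuple_base <= a < color_base k).
Proof.
apply/mapP/idP => [[i]|]; rewrite /color_base.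
  by rewrite mem_iota => lt ->; lia.
by exists (a - tuple_base); rewrite ?mem_iota; lia.
Qed.

Lemma mem_tail_cells k a :
  0 < k -> (a \in tail_cells k) = (tuple_base < a < color_base k).
Proof.
move=> k0; apply/mapP/idP => [[i]|]; rewrite /color_base.
  by rewrite mem_iota => lt ->; lia.
by exists (a - tuple_base); rewrite ?mem_iota; lia.
Qed.

Lemma tuple_cells_uniq k : uniq (tuple_cells k).
Proof. by rewrite map_inj_uniq ?iota_uniq //; apply: addnI. Qed.

Lemma tail_cells_uniq k : uniq (tail_cells k).
Proof. by rewrite map_inj_uniq ?iota_uniq //; apply: addnI. Qed.

Lemma tuple_cellsE k : 0 < k -> tuple_cells k = tuple_base :: tail_cells k.
Proof. by case: k => // k _; rewrite /tuple_cells /= addn0. Qed.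

Lemma map_tuple_cells k (m : memory) : m 5 = tuple_base ->
  [seq m (m 5 + i) | i <- iota 0 k] = map m (tuple_cells k).
Proof. by move=> ->; rewrite -map_comp. Qed.

(* Cells 10, 11 and 12 hold u, w and v.  Cell 9 counts the k-tuples that form a
   monochromatic edge of the current colouring, so that the value 0 stops both
   searches. *)
Definition codeg_body (a b acc : nat) : code :=
  CAdd tuple_base a 2 ;; CQuery 7 5 ;; CAdd tuple_base b 2 ;; CQuery 8 5 ;;
  CIf 7 (CIf 8 (CAdd acc acc 1) skip) skip.

Definition codeg_code (k a b acc : nat) : code :=
  CConst acc 0 ;; nest (tail_cells k) (codeg_body a b acc).

Definition color_sum (s : seq nat) : code :=
  foldr (fun r p => CAdd address_cell 3 r ;; CFetch 7 address_cell ;;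
                    CAdd 15 15 7 ;; p) skip s.

(** With colours 0 and 1, a k-tuple is monochromatic exactly when its colour sum, kept in cell 15,
    is 0 or at least [k]. *)
Definition check_body (k : nat) : code :=
  CQuery 8 5 ;;
  CIf 8 (CConst 15 0 ;; color_sum (tuple_cells k) ;;
         CIf 15 (CMonus 7 4 15 ;; CIf 7 skip (CAdd 9 9 1)) (CAdd 9 9 1))
        skip.

Definition check_code (k : nat) : code :=
  CConst 9 0 ;; nest (tuple_cells k) (check_body k).

Definition fill_body (k : nat) : code :=
  codeg_code k 10 12 13 ;; codeg_code k 10 11 14 ;; CMonus 7 13 14 ;;
  CIf 7 (CConst 8 1) (CConst 8 0) ;; CPut 12 8.

Definition search_code (k : nat) : code :=
  CFor 10 (CFor 11 (CIf 9 (CFor 12 (fill_body k) ;; check_code k) skip)).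

Lemma writes_color_sum s :
  {subset writes (color_sum s) <= [:: address_cell; 7; 15]}.
Proof.
elim: s => [|r s IH] a /=; first by rewrite !inE => ->.
rewrite !inE => /or4P[/eqP->|/eqP->|/eqP->|/IH] //.
by rewrite !inE.
Qed.

Lemma writes_check_body k :
  {subset writes (check_body k) <= [:: address_cell; 7; 8; 9; 15]}.
Proof.
move=> x; have := @writes_color_sum (tuple_cells k) x.
rewrite /check_body [writes _]/= !(inE, mem_cat) /address_cell.
by case: (x \in writes _) => [/(_ isT)|_]; lia.
Qed.

Lemma writes_codeg k a b acc : 0 < k ->
  all (fun x => (x \in [:: acc; address_cell; 7; 8]) || (x \in tuple_cells k))
    (writes (codeg_code k a b acc)).
Proof.
move=> k_gt0; rewrite /= writes_nest !inE eqxx /= all_cat; apply/andP; split.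
  apply/allP => y yt; apply/orP; right; move: yt.
  by rewrite mem_tail_cells // mem_tuple_cells => /andP[/ltnW-> ->].
apply/allP => y; rewrite !inE mem_tuple_cells /color_base; move: k_gt0.
by rewrite /address_cell /tuple_base; lia.
Qed.

Lemma writes_check k :
  all (fun x => (x \in [:: address_cell; 7; 8; 9; 15]) || (x \in tuple_cells k))
    (writes (check_code k)).
Proof.
rewrite /= writes_nest all_cat; apply/andP; split.
  by apply/allP => y ->; rewrite orbT.
by apply/allP => y /writes_check_body ->.
Qed.

(** * Correctness of the codegree search *)

Section Correctness.
Variables (k n : nat) (H : {set {set 'I_n}}).
Hypothesis k_gt0 : 0 < k.
Implicit Type m : memory.

Lemma put_free_frame (s : seq nat) (p : code) m a :
  well_formed k p -> put_free p -> ctx k n m ->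
  all (fun x => (x \in s) || (x \in tuple_cells k)) (writes p) ->
  a \notin s -> a \notin tuple_cells k -> den k H p m a = m a.
Proof.
move=> wp pp cm /allP sub as_ at_; apply: den_frame => //; first by rewrite pp orbT.
by apply/negP => /sub; rewrite (negPf as_) (negPf at_).
Qed.

(** Each pass sees one tuple in the counter cells and adds its [g]-value to [acc]. The hypothesis on
    the body may use that cells outside [writes] still agree with [m0], which keeps its other inputs
    fixed. *)
Lemma den_nest (s0 : seq nat) (p : code) (acc : nat) (g : seq nat -> nat) m0 :
  well_formed k (nest s0 p) -> put_free p -> acc \notin s0 -> ctx k n m0 ->
  (forall m, ctx k n m ->
    (forall a, a \notin writes (nest s0 p) -> m a = m0 a) ->
    den k H p m acc = m acc + g (map m s0)) ->
  den k H (nest s0 p) m0 acc = m0 acc + \sum_(l <- all_tuples n (size s0)) g l.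
Proof.
move=> wf0 pf accs c0 body; set W := writes (nest s0 p) in body.
move: (wf0); rewrite well_formed_nest => /and4P[us0 /allP s0p /allP s0r wp].
(* [d] lists the outer counters, whose values are fixed, and [s] those still to be looped over. *)
suff gen s d m : s0 = d ++ s -> ctx k n m ->
    (forall a, a \notin W -> m a = m0 a) ->
    den k H (nest s p) m acc
      = m acc + \sum_(l <- all_tuples n (size s)) g (map m d ++ l).
  exact: (gen s0 [::] m0).
elim: s d m => [|x s IH] d m s0E cm mW.
  rewrite big_seq1 cats0 -(cats0 d) -s0E; exact: body.
have x0 : x \in s0 by rewrite s0E mem_cat inE eqxx orbT.
have xW : x \in W by rewrite /W writes_nest mem_cat x0.
have s0E' : s0 = rcons d x ++ s by rewrite cat_rcons.
have ctxx m' i : ctx k n m' -> ctx k n (upd m' x i).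
  by apply: ctx_eq => b b6; rewrite upd_neq //; have := s0r x x0; lia.
have accx : acc != x by apply: contraNneq accs => ->.
have uds : uniq (d ++ x :: s) by rewrite -s0E.
have dx y : y \in d -> y != x.
  move=> yd; move: uds; rewrite cat_uniq => /and3P[_ /hasPn h _].
  by apply: contraTneq yd => ->; apply: h; rewrite inE eqxx.
have wfs : well_formed k (nest s p).
  rewrite well_formed_nest wp andbT.
  move: uds; rewrite cat_uniq /= => /and4P[_ _ _ ->] /=.
  by apply/andP; split; apply/allP => y ys; [apply: s0p|apply: s0r];
    rewrite s0E mem_cat inE ys !orbT.
have dfr y : y \in d -> y \notin writes (nest s p).
  move=> yd; rewrite writes_nest mem_cat negb_or s0p; last by rewrite s0E mem_cat yd.
  move: uds; rewrite cat_uniq => /and3P[_ /hasPn h _].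
  by rewrite andbT; apply/negP => ys; have := h y; rewrite inE ys orbT yd => /(_ isT).
have fr m' y : ctx k n m' -> y \notin writes (nest s p) ->
    den k H (nest s p) m' y = m' y.
  by move=> cm' yw; apply: den_frame; rewrite ?put_free_nest ?pf ?orbT.
pose S j := \sum_(l <- all_tuples n (size s)) g (map m d ++ j :: l).
have -> : \sum_(l <- all_tuples n (size (x :: s))) g (map m d ++ l)
    = \sum_(0 <= j < n) S j.
  rewrite /= big_flatten big_map /index_iota subn0.
  by apply: eq_bigr => j _; rewrite big_map.
pose J i m' := [/\ ctx k n m', forall a, a \notin W -> m' a = m0 a,
  map m' d = map m d & m' acc = m acc + \sum_(i <= j < n) S j].
suff [] : J 0 (den k H (nest (x :: s) p) m) by [].
apply: den_for_ind; first exact: ctx0 cm.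
  split; [exact: ctxx| | |].
  - move=> a aW; rewrite upd_neq ?mW //; by apply: contraNneq aW => ->.
  - by apply/eq_in_map => y yd; rewrite upd_neq // dx.
  - by rewrite upd_neq // big_geq // addn0.
move=> i m' lt [cm' m'W m'd m'acc]; have cx := ctxx m' i cm'.
have m1W a : a \notin W -> upd m' x i a = m0 a.
  by move=> aW; rewrite upd_neq ?m'W //; apply: contraNneq aW => ->.
split; first exact: den_ctx.
- move=> a aW; rewrite fr ?m1W //; apply: contra aW.
  by rewrite /W !writes_nest s0E !mem_cat inE => /orP[->|->]; rewrite ?orbT.
- rewrite -m'd; apply/eq_in_map => y yd.
  by rewrite fr ?upd_neq ?dx // dfr.
- rewrite (IH (rcons d x)) // upd_neq // m'acc [in RHS]big_ltn // [S i + _]addnC addnA.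
  congr (_ + _); apply: eq_bigr => l _; congr g.
  rewrite map_rcons updE cat_rcons; congr (_ ++ _).
  by rewrite -m'd; apply/eq_in_map => y yd; rewrite upd_neq ?dx.
Qed.

(** The quantity the program computes: it counts ordered tuples, which rescales every codegree by
    the same factor and leaves comparisons unchanged. *)
Definition codegN (u v : nat) : nat :=
  \sum_(l <- all_tuples n k.-1) (edge_oracle H (u :: l) && edge_oracle H (v :: l)).

Let small (a : nat) := (8 < a < tuple_base).

Lemma well_formed_codeg a b acc : small acc -> well_formed k (codeg_code k a b acc).
Proof.
rewrite /small => /andP[a1 a2].
have aB : 5 < acc < color_base k by rewrite /color_base; lia.
have t : 5 < tuple_base < color_base k by rewrite /color_base; lia.
rewrite /codeg_code well_formed2 well_formed_nest tail_cells_uniq.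
apply/and5P; split => //.
- by rewrite /well_formed /= aB.
- apply/allP => x; rewrite mem_tail_cells // !inE; move: a2.
  by rewrite /tuple_base /address_cell; lia.
- by apply/allP => x; rewrite mem_tail_cells //; rewrite /tuple_base; lia.
- apply/andP; split=> //; apply/allP => x; rewrite !inE /address_cell; move: aB t.
  by rewrite /color_base /tuple_base; lia.
Qed.

Lemma frame_codeg a b acc m x : small acc -> ctx k n m ->
  x \notin [:: acc; address_cell; 7; 8] -> x \notin tuple_cells k ->
  den k H (codeg_code k a b acc) m x = m x.
Proof.
move=> sa cm; apply: put_free_frame => //; first exact: well_formed_codeg.
  by rewrite /= put_free_nest.
exact: writes_codeg.
Qed.

Lemma den_codeg_body a b acc m :
  small a -> small b -> small acc -> ctx k n m ->
  den k H (codeg_body a b acc) m acc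
    = m acc + (edge_oracle H (m a :: map m (tail_cells k))
               && edge_oracle H (m b :: map m (tail_cells k))).
Proof.
rewrite /small => /andP[a1 a2] /andP[b1 b2] /andP[c1 c2] cm.
have tl m' : (forall y, tuple_base < y -> m' y = m y) ->
    map m' (tail_cells k) = map m (tail_cells k).
  by move=> E; apply/eq_in_map => y; rewrite mem_tail_cells // => /andP[/E].
rewrite /codeg_body /=.
set m1 := upd m tuple_base _.
have E1 : [seq m1 (m1 5 + i) | i <- iota 0 k] = m a :: map m (tail_cells k).
  rewrite map_tuple_cells /m1 ?upd_neq ?(ctx5 cm) // tuple_cellsE //= updE.
  rewrite (ctx2 cm) addn0 tl // => y ty; rewrite upd_neq //; lia.
rewrite E1; set q1 := edge_oracle H _; set m2 := upd m1 7 _.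
have m2b : m2 b + m2 2 = m b.
  by rewrite /m2 /m1 !upd_neq ?(ctx2 cm) ?addn0 //; lia.
rewrite m2b; set m3 := upd m2 tuple_base _.
have E3 : [seq m3 (m3 5 + i) | i <- iota 0 k] = m b :: map m (tail_cells k).
  rewrite map_tuple_cells /m3 /m2 /m1 ?upd_neq ?(ctx5 cm) //.
  rewrite tuple_cellsE //= updE tl // => y ty; rewrite !upd_neq //;
    move: ty; rewrite /tuple_base; lia.
rewrite E3; set q2 := edge_oracle H _; set m4 := upd m3 8 _.
have m47 : m4 7 = q1 by rewrite /m4 /m3 upd_neq // upd_neq // /m2 updE.
have m48 : m4 8 = q2 by rewrite /m4 updE.
have m4acc : m4 acc = m acc.
  by rewrite /m4 /m3 /m2 /m1 !upd_neq //; lia.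
have m41 : m4 1 = 1.
  by rewrite /m4 /m3 /m2 /m1 !upd_neq ?(ctx1 cm).
have m46 : upd m4 address_cell 0 acc = m acc.
  by rewrite upd_neq // /address_cell; lia.
rewrite m47 m48; case: (q1) => /=; last by rewrite m46 addn0.
by case: (q2) => /=; [rewrite updE m4acc m41|rewrite m46 addn0].
Qed.

Lemma den_codeg a b acc m :
  small a -> small b -> small acc -> a != acc -> b != acc -> ctx k n m ->
  den k H (codeg_code k a b acc) m acc = codegN (m a) (m b).
Proof.
move=> sa sb sc ac bc cm; rewrite /codeg_code /=; set m0 := upd m acc 0.
have c0 : ctx k n m0.
  by apply: ctx_eq cm => y y6; rewrite /m0 upd_neq //; move: sc; rewrite /small; lia.
have wf := @well_formed_codeg a b acc sc.
rewrite (@den_nest _ _ _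
  (fun l => edge_oracle H (m a :: l) && edge_oracle H (m b :: l))) //.
- by rewrite /m0 updE add0n size_map size_iota.
- by move: wf; rewrite well_formed2 => /andP[].
- rewrite mem_tail_cells //; move: sc; rewrite /small; lia.
move=> m' cm' fr; rewrite den_codeg_body //.
have out y : small y -> y != acc ->
    y \notin writes (nest (tail_cells k) (codeg_body a b acc)).
  rewrite /small => /andP[y1 y2] yc.
  rewrite writes_nest mem_cat mem_tail_cells // !inE /= (negPf yc).
  by rewrite /address_cell; move: y1 y2; rewrite /tuple_base; lia.
by rewrite (fr a) ?out // (fr b) ?out // /m0 !upd_neq.
Qed.

Let arr m (x : nat) : nat := m (color_base k + x).

Lemma arr_upd m a y x : a < color_base k -> arr (upd m a y) x = arr m x.
Proof. by move=> aB; rewrite /arr upd_neq //; lia. Qed.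

Lemma den_color_sum s m : {subset s <= tuple_cells k} -> ctx k n m ->
  den k H (color_sum s) m 15 = m 15 + \sum_(r <- s) arr m (m r).
Proof.
elim: s m => [|r s IH] m sub cm; first by rewrite big_nil addn0 /= upd_neq.
have B15 : 15 < color_base k by rewrite /color_base /tuple_base; lia.
have out x : x \in tuple_cells k -> [/\ x != 6, x != 7 & x != 15].
  by rewrite mem_tuple_cells /tuple_base => xt; split; lia.
rewrite [den _ _ _ _]/= -/(color_sum s); set m1 := upd m _ _; set m2 := upd m1 _ _.
set m3 := upd m2 _ _.
have m3E x : x != 6 -> x != 7 -> x != 15 -> m3 x = m x.
  by move=> x6 x7 x15; rewrite /m3 /m2 /m1 !upd_neq.
have c3 : ctx k n m3 by apply: ctx_eq cm => a a6; apply: m3E; lia.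
have m1r : m1 (m1 address_cell) = arr m (m r).
  rewrite /m1 updE (ctx3 cm) upd_neq //; move: B15; rewrite /address_cell; lia.
rewrite IH //; last by move=> x xs; apply: sub; rewrite inE xs orbT.
rewrite big_cons addnA; congr (_ + _).
  by rewrite /m3 updE /m2 updE m1r upd_neq // /m1 upd_neq.
rewrite !big_seq; apply: eq_bigr => x xs.
have [|x6 x7 x15] := out x; first by apply: sub; rewrite inE xs orbT.
by rewrite m3E // /arr m3E //; lia.
Qed.

Definition monoN m (l : seq nat) : bool :=
  let s := \sum_(x <- l) arr m x in (s == 0) || (k <= s).

Lemma den_check_body m : ctx k n m ->
  den k H (check_body k) m 9
    = m 9 + (edge_oracle H (map m (tuple_cells k)) && monoN m (map m (tuple_cells k))).
Proof.
move=> cm; rewrite /check_body [den _ _ _ _]/= map_tuple_cells ?(ctx5 cm) //.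
set q := edge_oracle H _; set m1 := upd m 8 _.
have m18 : m1 8 = q by rewrite /m1 updE.
rewrite m18; case: (q) => /=; last by rewrite !upd_neq // addn0.
set m2 := upd m1 15 0; set m3 := den k H _ m2.
have B15 : 15 < color_base k by rewrite /color_base /tuple_base; lia.
have c2 : ctx k n m2.
  by apply: ctx_eq cm => a a6; rewrite /m2 /m1 !upd_neq //; lia.
have m3s : m3 15 = \sum_(x <- map m (tuple_cells k)) arr m x.
  rewrite /m3 den_color_sum // {1}/m2 updE add0n big_map !big_seq.
  apply: eq_bigr => x; rewrite mem_tuple_cells /tuple_base => xt.
  by rewrite /m2 /m1 !arr_upd ?upd_neq //; lia.
have fr a : a \notin [:: address_cell; 7; 15] -> m3 a = m2 a.
  move=> aw; have wfs : well_formed k (color_sum (tuple_cells k)).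
    rewrite /well_formed; apply/andP; split.
      by elim: (tuple_cells k) => //= r s ->.
    apply/allP => x /writes_color_sum; rewrite !inE /address_cell.
    by move: B15; lia.
  apply: den_frame => //.
    by apply/orP; right; elim: (tuple_cells k) => //= r s ->.
  by apply: contra aw => /writes_color_sum.
have m39 : m3 9 = m 9 by rewrite fr // /m2 /m1 !upd_neq.
have m31 : m3 1 = 1 by rewrite fr // (ctx1 c2).
have m34 : m3 4 = k by rewrite fr // (ctx4 c2).
rewrite /monoN /= -m3s; set sm := m3 15.
case: (eqVneq sm 0) => [s0|s0] /=; first by rewrite updE m39 m31.
rewrite updE m34 -/sm subn_eq0; case: (k <= sm) => /=.
  by rewrite updE !upd_neq // m39 m31.
by rewrite !upd_neq // m39 addn0.
Qed.

Lemma well_formed_check : well_formed k (check_code k).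
Proof.
have B20 : 20 < color_base k by rewrite /color_base /tuple_base; lia.
have sub := @writes_check_body k.
rewrite /check_code well_formed2 well_formed_nest tuple_cells_uniq.
apply/and5P; split => //.
- apply/allP => x; rewrite mem_tuple_cells => xt; apply/negP => /sub.
  by move: xt; rewrite !inE /tuple_base /address_cell; lia.
- by apply/allP => x; rewrite mem_tuple_cells /tuple_base; lia.
apply/andP; split.
  by rewrite /=; apply/andP; split=> //; elim: (tuple_cells k) => //= r s ->.
by apply/allP => x /sub; rewrite !inE /address_cell; lia.
Qed.

Lemma put_free_check : put_free (check_code k).
Proof.
rewrite /= put_free_nest /= andbT.
by elim: (tuple_cells k) => //= r s.
Qed.

Lemma frame_check m x : ctx k n m ->
  x \notin [:: address_cell; 7; 8; 9; 15] -> x \notin tuple_cells k ->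
  den k H (check_code k) m x = m x.
Proof.
move=> cm; apply: put_free_frame => //.
- exact: well_formed_check.
- exact: put_free_check.
exact: writes_check.
Qed.

Lemma den_check m : ctx k n m ->
  den k H (check_code k) m 9
    = \sum_(l <- all_tuples n k) (edge_oracle H l && monoN m l).
Proof.
move=> cm; rewrite /check_code [den _ _ _ _]/=; set m0 := upd m 9 0.
have c0 : ctx k n m0 by apply: ctx_eq cm => a a6; rewrite /m0 upd_neq //; lia.
rewrite (@den_nest _ _ _ (fun l => edge_oracle H l && monoN m l)) //.
- by rewrite /m0 updE add0n size_map size_iota.
- by have := well_formed_check; rewrite well_formed2 => /andP[].
- by have /= := put_free_check; rewrite put_free_nest.
- by rewrite mem_tuple_cells.
move=> m' cm' fr; rewrite den_check_body //.
have E : arr m' =1 arr m.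
  move=> x; rewrite -(arr_upd m 0 x (_ : 9 < color_base k)) /color_base //.
  apply: fr; apply/negP => xw.
  have := well_formedP (a := color_base k + x) well_formed_check.
  by rewrite /= inE xw orbT => /(_ isT); lia.
by congr (_ + (_ && _)); rewrite /monoN; under eq_bigr do rewrite E.
Qed.

Definition coloring_of m : {ffun 'I_n -> bool} := [ffun v : 'I_n => arr m v != 0].

Lemma edge_oracle_map (l : seq 'I_n) :
  edge_oracle H (map val l) = ([set v in l] \in H).
Proof.
rewrite /edge_oracle (_ : [set v | _] = [set v in l]) //.
by apply/setP => v; rewrite !inE mem_map //; apply: val_inj.
Qed.

Lemma all_tuples_map j (l : seq nat) : l \in all_tuples n j ->
  exists2 l' : seq 'I_n, size l' = j & l = map val l'.
Proof.
rewrite mem_all_tuples => /andP[/eqP sl /allP al].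
exists (pmap insub l); last first.
  rewrite pmap_filter; last by move=> x; apply: insubK.
  rewrite -[LHS]filter_predT; apply/eq_in_filter => x xl.
  by rewrite isSome_insub; apply/esym/al.
apply/eqP; rewrite size_pmap -sl -all_count; apply/allP => x xl.
by rewrite /= isSome_insub; apply: al.
Qed.

(** Each edge is met as the enumeration of its vertices, which has length [k] by uniformity;
    conversely every tuple accepted by the oracle spans an edge. *)
Lemma check_proper m : ctx k n m -> uniform k H -> (forall x, arr m x <= 1) ->
  (den k H (check_code k) m 9 == 0) = proper_coloring H (coloring_of m).
Proof.
move=> cm /forallP U bits; rewrite den_check // sum_nat_seq_eq0.
have mono (l : seq 'I_n) : size l = k ->
    monoN m (map val l) = monochromatic (coloring_of m) [set v in l].
  move=> sl; rewrite /monoN big_map.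
  have -> : (\sum_(x <- l) arr m x == 0) = all (fun v => ~~ coloring_of m v) l.
    rewrite sum_nat_seq_eq0; apply: eq_all => v; by rewrite ffunE negbK.
  have -> : (k <= \sum_(x <- l) arr m x) = all (coloring_of m) l.
    rewrite -sl; elim: {sl} l => [|v l IH]; first by rewrite big_nil.
    rewrite big_cons /= -IH ffunE.
    have : \sum_(x <- l) arr m x <= size l.
      rewrite -sum1_size; exact: leq_sum.
    by have := bits v; case: (arr m v) => [|[|]] //; lia.
  apply/orP/existsP => [[] /allP h|[b /forallP h]].
  - by exists false; apply/forallP => v; apply/implyP; rewrite inE => /h /negPf ->.
  - by exists true; apply/forallP => v; apply/implyP; rewrite inE => /h ->.
  - case: b h => h; [right|left]; apply/allP => v vl; have := h v;
      by rewrite inE vl => /eqP ->.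
apply/allP/forallP => [h e|h l].
  apply/implyP => eH; have := U e; rewrite eH => /eqP ek.
  have sl : size (enum e) = k by rewrite -cardE.
  have := h (map val (enum e)); rewrite mem_all_tuples size_map sl eqxx.
  have -> : all (ltn^~ n) (map val (enum e)).
    by apply/allP => x /mapP[v _ ->]; apply: ltn_ord.
  rewrite edge_oracle_map mono //.
  have -> : [set v in enum e] = e by apply/setP => v; rewrite inE mem_enum.
  by rewrite eH => /(_ isT); rewrite eqb0.
case/all_tuples_map=> l' sl ->; rewrite edge_oracle_map mono //=.
by rewrite eqb0; have := h [set v in l']; case: (_ \in H).
Qed.

Lemma card_tuples_of_set (j : nat) (f : {set 'I_n}) : #|f| = j ->
  #|[set t : j.-tuple 'I_n | [set x in t] == f]| = j`!.
Proof.
move=> fj; have -> : j`! = #|f| ^_ j by rewrite fj ffactnn.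
rewrite -card_uniq_tuples; apply: eq_card => t.
rewrite !inE; apply/eqP/andP => [tf|[/allP tf ut]].
  split; first by apply/allP => x xt; move/setP/(_ x): tf; rewrite inE xt => /esym.
  by apply/card_uniqP; rewrite size_tuple -[RHS]fj -tf cardsE.
apply/eqP; rewrite eqEcard; apply/andP; split.
  by apply/subsetP => x; rewrite inE => /tf.
by rewrite fj cardsE (card_uniqP ut) size_tuple.
Qed.

(** Group the tuples by their underlying set [f]. If [f] contained [u] or [v], it would itself be an
    edge with [k] elements, too many for a (k-1)-tuple; otherwise it has [k - 1] elements and all
    its orderings count. *)
Lemma codegN_codeg (u v : 'I_n) : uniform k H ->
  codegN u v = k.-1`! * codeg H u v.
Proof.
move=> /forallP U; set j := k.-1.
pose P (f : {set 'I_n}) := (u |: f \in H) && (v |: f \in H).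
have -> : codegN u v = \sum_(t : j.-tuple 'I_n) P [set x in t].
  rewrite /codegN -/j.
  rewrite (perm_big [seq map val (val t) | t <- enum {: j.-tuple 'I_n}]); last first.
    apply: uniq_perm; first exact: all_tuples_uniq.
      rewrite map_inj_uniq ?enum_uniq // => t t' /(inj_map val_inj).
      exact: val_inj.
    move=> l; apply/idP/mapP => [/all_tuples_map[l' /eqP sl ->]|[t _ ->]].
      by exists (Tuple sl); rewrite ?mem_enum.
    rewrite mem_all_tuples size_map size_tuple eqxx.
    by apply/allP => x /mapP[y _ ->]; apply: ltn_ord.
  rewrite big_map big_enum; apply: eq_bigr => t _.
  have E (y : 'I_n) : y |: [set x in t] = [set x in y :: t].
    by apply/setP => x; rewrite !inE.
  by rewrite /P !E -!edge_oracle_map.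
rewrite (partition_big (fun t : j.-tuple 'I_n => [set x in t]) xpredT) //=.
rewrite /codeg -sum1_card big_distrr /= [RHS]big_mkcond; apply: eq_bigr => f _.
rewrite (eq_bigr (fun=> P f : nat)); last by move=> t /eqP ->.
rewrite sum_nat_const inE muln1 /P.
case: (boolP (u |: f \in H)) => uH; last by rewrite !andbF muln0.
case: (boolP (v |: f \in H)) => vH; last by rewrite !andbF muln0.
have card_t (t : j.-tuple 'I_n) : #|[set x in t]| < k.
  by rewrite cardsE (leq_ltn_trans (card_size _)) // size_tuple ltn_predL.
have card_f y : y |: f \in H -> y \in f -> #|f| = k.
  by move=> yH yf; have := U (y |: f); rewrite yH (setUidPr _) ?sub1set // => /eqP.
have none : #|f| = k -> #|[pred t : j.-tuple 'I_n | [set x in t] == f]| = 0.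
  by move=> fk; apply: eq_card0 => t; rewrite !inE; apply/negP => /eqP tf;
    have := card_t t; rewrite tf fk ltnn.
rewrite muln1 !andbT; case: (boolP (u \in f)) => uf /=.
  exact: none (card_f u _ _).
case: (boolP (v \in f)) => vf /=; first exact: none (card_f v _ _).
rewrite -(card_tuples_of_set (j := j) (f := f)).
  by apply: eq_card => t; rewrite !inE.
by have := U (u |: f); rewrite uH cardsU1 uf => /eqP; rewrite /j => <-.
Qed.

Lemma well_formed_fill : well_formed k (fill_body k).
Proof.
by rewrite /fill_body well_formed2 well_formed_codeg // well_formed2 well_formed_codeg.
Qed.

Lemma den_fill_body m : ctx k n m ->
  let m' := den k H (fill_body k) m in
  [/\ arr m' (m 12) = (codegN (m 10) (m 11) < codegN (m 10) (m 12)),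
    forall x, x != m 12 -> arr m' x = arr m x &
    forall a, a < color_base k -> a \notin [:: address_cell; 7; 8; 13; 14] ->
      a \notin tuple_cells k -> m' a = m a].
Proof.
move=> cm m'.
pose m1 := den k H (codeg_code k 10 12 13) m.
pose m2 := den k H (codeg_code k 10 11 14) m1.
pose m3 := upd m2 7 (m2 13 - m2 14).
pose m4 := if m3 7 != 0 then upd m3 8 1 else upd m3 8 0.
pose m5 := upd m4 address_cell (m4 3 + m4 12).
have -> : m' = upd m5 (m4 3 + m4 12) (m5 8) by [].
clear m'.
have wf1 : well_formed k (codeg_code k 10 12 13) by rewrite well_formed_codeg.
have wf2 : well_formed k (codeg_code k 10 11 14) by rewrite well_formed_codeg.
have c1 : ctx k n m1 by apply: den_ctx.
have c2 : ctx k n m2 by apply: den_ctx.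
have nt a : a < tuple_base -> a \notin tuple_cells k.
  by rewrite mem_tuple_cells; lia.
have m2a : m2 13 = codegN (m 10) (m 12).
  by rewrite /m2 frame_codeg ?nt // /m1 den_codeg.
have m2b : m2 14 = codegN (m 10) (m 11).
  by rewrite /m2 den_codeg // /m1 !frame_codeg ?nt.
have m2E a : a \notin [:: address_cell; 7; 8; 13; 14] ->
    a \notin tuple_cells k -> m2 a = m a.
  rewrite !inE => aw at_; rewrite /m2 frame_codeg //; last by rewrite !inE; lia.
  by rewrite /m1 frame_codeg //; rewrite !inE; lia.
have m37 : (m3 7 != 0) = (codegN (m 10) (m 11) < codegN (m 10) (m 12)).
  by rewrite /m3 updE m2a m2b subn_eq0 ltnNge.
have m48 : m4 8 = (m3 7 != 0) by rewrite /m4; case: ifP => _; rewrite updE.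
have m4E a : a != 7 -> a != 8 -> m4 a = m2 a.
  by move=> a7 a8; rewrite /m4; case: ifP => _; rewrite upd_neq // /m3 upd_neq.
have m43 : m4 3 + m4 12 = color_base k + m 12.
  by rewrite !m4E // (ctx3 c2) (m2E 12) ?nt.
rewrite m43.
have B20 : 20 < color_base k by rewrite /color_base /tuple_base; lia.
split.
- by rewrite /arr updE /m5 upd_neq // m48 m37.
- move=> x xn; rewrite /arr upd_neq ?eqn_add2l // /m5 upd_neq; last first.
    by rewrite /address_cell; lia.
  rewrite m4E; [apply: m2E|lia|lia].
    by rewrite !inE /address_cell; lia.
  by rewrite mem_tuple_cells; lia.
- move=> a aB aw at_; rewrite upd_neq; last by lia.
  move: (aw); rewrite !inE !negb_or => /and5P[a6 a7 a8 a13 a14].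
  by rewrite /m5 upd_neq // m4E // m2E.
Qed.

Let inert m m' := forall a, a < color_base k ->
  a \notin [:: address_cell; 7; 8; 12; 13; 14] -> a \notin tuple_cells k ->
  m' a = m a.

Lemma den_fill m : ctx k n m ->
  let m' := den k H (CFor 12 (fill_body k)) m in
  [/\ forall x, x < n -> arr m' x = (codegN (m 10) (m 11) < codegN (m 10) x),
    forall x, n <= x -> arr m' x = arr m x & inert m m'].
Proof.
move=> cm.
have B20 : 20 < color_base k by rewrite /color_base /tuple_base; lia.
pose J i m' := [/\ forall x, i <= x < n ->
    arr m' x = (codegN (m 10) (m 11) < codegN (m 10) x),
    forall x, n <= x -> arr m' x = arr m x & inert m m'].
suff [J1 J2 J3] : J 0 (den k H (CFor 12 (fill_body k)) m).
  by split=> // x lt; apply: J1.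
have in12 m' i : inert m m' -> inert m (upd m' 12 i).
  move=> h a aB aw at_; rewrite upd_neq ?h //.
  by apply: contraNneq aw => ->.
have small_nt a : a < tuple_base -> a \notin tuple_cells k.
  by rewrite mem_tuple_cells; lia.
apply: den_for_ind; first exact: ctx0 cm.
- split=> [x|x _|]; first by lia.
    by rewrite arr_upd //; lia.
  exact: in12.
move=> i m' lt [J1 J2 J3]; set m1 := upd m' 12 i.
have i1 : inert m m1 by apply: in12.
have c1 : ctx k n m1.
  apply: ctx_eq cm => a a6; apply: i1; first by lia.
    by rewrite !inE /address_cell; lia.
  by apply: small_nt; rewrite /tuple_base; lia.
have [F1 F2 F3] := den_fill_body c1.
have m12 : m1 12 = i by rewrite /m1 updE.
have m1u : m1 10 = m 10 by apply: i1; rewrite ?small_nt //; lia.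
have m1w : m1 11 = m 11 by apply: i1; rewrite ?small_nt //; lia.
have a1 x : arr m1 x = arr m' x by rewrite arr_upd //; lia.
rewrite m12 m1u m1w in F1 F2.
split.
- move=> x /andP[ix xn]; have [->|xi] := eqVneq x i; first by rewrite F1.
  by rewrite F2 // a1 J1 // xn andbT; lia.
- by move=> x nx; rewrite F2 ?a1 ?J2 //; lia.
- move=> a aB aw at_; rewrite F3 ?i1 //.
  by apply: contra aw; rewrite !inE; lia.
Qed.

(** The second condition lets the array left by the codegree search be read as a binary number below
    [2 ^ n]. *)
Definition bits m := (forall x, arr m x <= 1) /\ (forall x, n <= x -> arr m x = 0).

Lemma arr_fill m (u w : 'I_n) : uniform k H -> ctx k n m ->
  m 10 = u -> m 11 = w ->
  coloring_of (den k H (CFor 12 (fill_body k)) m) = candidate H u w.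
Proof.
move=> U cm mu mw; have [F1 _ _] := den_fill cm.
apply/ffunP => v; rewrite !ffunE F1 // mu mw eqb0 negbK !codegN_codeg //.
by rewrite ltn_pmul2l // fact_gt0.
Qed.

Lemma writes_fill a : a \in writes (fill_body k) ->
  (a \in [:: address_cell; 7; 8; 13; 14]) || (a \in tuple_cells k).
Proof.
have sub acc x y : a \in writes (codeg_code k x y acc) ->
    (a \in [:: acc; address_cell; 7; 8]) || (a \in tuple_cells k).
  by move/(allP (writes_codeg x y acc k_gt0)).
have -> : writes (fill_body k) = writes (codeg_code k 10 12 13)
  ++ writes (codeg_code k 10 11 14) ++ [:: 7; 8; 8; address_cell] by [].
rewrite mem_cat => /orP[/sub|]; first by rewrite !inE; lia.
by rewrite mem_cat => /orP[/sub|]; rewrite !inE; lia.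
Qed.

Lemma well_formed_fill_loop : well_formed k (CFor 12 (fill_body k)).
Proof.
rewrite well_formed_for well_formed_fill andbT; apply/andP; split=> //.
by apply/negP => /writes_fill; rewrite !inE mem_tuple_cells.
Qed.

Lemma well_formed_search : well_formed k (search_code k).
Proof.
pose p := CIf 9 (CFor 12 (fill_body k) ;; check_code k) skip.
have wp : well_formed k p.
  by rewrite well_formed_if well_formed2 well_formed_fill_loop well_formed_check.
have out a : 9 < a < 12 -> a \notin writes p.
  move=> ar; have -> : writes p = ((12 :: writes (fill_body k))
    ++ writes (check_code k)) ++ [:: address_cell] by [].
  rewrite mem_cat negb_or; apply/andP; split; last by rewrite inE /address_cell; lia.
  apply/negP; rewrite mem_cat inE => /orP[/orP[|/writes_fill]|].
  - lia.
  - by rewrite !inE mem_tuple_cells /tuple_base /address_cell; lia.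
  - move/(allP (writes_check k)).
    by rewrite !inE mem_tuple_cells /tuple_base /address_cell; lia.
rewrite /search_code !well_formed_for wp !out //= inE negb_or out //.
Qed.

(** The search invariant: the value 0 in cell 9 certifies the colouring currently in the array. *)
Definition sound m := [/\ ctx k n m, bits m &
  m 9 = 0 -> proper_coloring H (coloring_of m)].

Lemma sound_upd m a x : 5 < a < tuple_base -> a != 9 -> sound m -> sound (upd m a x).
Proof.
move=> /andP[a5 aB] a9 [cm [b1 b2] pr].
have aC : a < color_base k by rewrite /color_base; lia.
split.
- by apply: ctx_eq cm => y y6; rewrite upd_neq //; lia.
- by split=> y => [|yn]; rewrite arr_upd ?b1 ?b2.
- rewrite upd_neq ?[9 == a]eq_sym // => /pr.
  congr proper_coloring; apply/ffunP => v; by rewrite !ffunE arr_upd.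
Qed.

(** When cell 9 is already 0 the body touches only a scratch cell, so a success persists; otherwise
    the array is refilled and the check decides cell 9. *)
Lemma den_search_body m (u w : 'I_n) : uniform k H -> sound m ->
  m 10 = u -> m 11 = w ->
  let m' := den k H (CIf 9 (CFor 12 (fill_body k) ;; check_code k) skip) m in
  [/\ sound m', m' 10 = u, m 9 = 0 -> m' 9 = 0 &
    proper_coloring H (candidate H u w) -> m' 9 = 0].
Proof.
move=> U sm mu mw m'.
have small_nt a : a < tuple_base -> a \notin tuple_cells k.
  by rewrite mem_tuple_cells; lia.
have [m9|m9] := eqVneq (m 9) 0.
  have -> : m' = upd m address_cell 0 by rewrite /m' /= m9.
  by split; rewrite ?upd_neq //; apply: sound_upd.
pose m1 := den k H (CFor 12 (fill_body k)) m.
have -> : m' = den k H (check_code k) m1 by rewrite /m' /= m9.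
case: (sm) => cm [b1 b2] _; have [F1 F2 F3] := den_fill cm; rewrite -/m1 in F1 F2 F3.
have c1 : ctx k n m1 by apply: den_ctx; [exact: well_formed_fill_loop|].
have bits1 : bits m1.
  split=> x => [|nx]; last by rewrite F2 ?b2.
  by have [xn|xn] := ltnP x n; [rewrite F1 // leq_b1|rewrite F2 ?b2].
have arr' x : arr (den k H (check_code k) m1) x = arr m1 x.
  by rewrite /arr frame_check // mem_tuple_cells; lia.
have col' : coloring_of (den k H (check_code k) m1) = coloring_of m1.
  by apply/ffunP => v; rewrite !ffunE arr'.
have CP := check_proper c1 U bits1.1.
split.
- split; first by apply: den_ctx; [exact: well_formed_check|].
    by split=> x => [|nx]; rewrite arr' ?bits1.1 ?bits1.2.
  by rewrite col' -CP => ->.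
- by rewrite frame_check ?small_nt // F3 ?small_nt // /color_base /tuple_base; lia.
- by move/eqP; rewrite (negPf m9).
- by move=> P; apply/eqP; rewrite CP (arr_fill U cm mu mw).
Qed.

Lemma den_search m : uniform k H -> sound m ->
  let m' := den k H (search_code k) m in
  sound m' /\ (~~ bad H -> m' 9 = 0).
Proof.
move=> U sm.
(* Loops count downwards, so the passes already made are those with [u <= u']. *)
pose J u m' := sound m' /\ forall u' w : 'I_n, u <= u' ->
  proper_coloring H (candidate H u' w) -> m' 9 = 0.
suff [sm' J0] : J 0 (den k H (search_code k) m).
  split=> //; rewrite negb_forall => /existsP[u]; rewrite negb_forall => /existsP[w].
  by rewrite negbK; apply: J0.
apply: den_for_ind; first by case: sm => /ctx0.
  by split=> [|u' w]; [apply: sound_upd|rewrite leqNgt ltn_ord].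
move=> i m1 lt [s1 J1]; pose u := Ordinal lt.
pose J2 w m' := [/\ sound m', m' 10 = u,
  forall u' w' : 'I_n, u < u' -> proper_coloring H (candidate H u' w') -> m' 9 = 0 &
  forall w' : 'I_n, w <= w' -> proper_coloring H (candidate H u w') -> m' 9 = 0].
pose p := CIf 9 (CFor 12 (fill_body k) ;; check_code k) skip.
suff [s2 _ h1 h2] : J2 0 (den k H (CFor 11 p) (upd m1 10 i)).
  split=> // u' w'; rewrite leq_eqVlt => /orP[/eqP uu'|]; last exact: h1.
  have -> : u' = u by apply: val_inj.
  exact: h2.
have s1' : sound (upd m1 10 i) by apply: sound_upd.
apply: den_for_ind; first by case: s1' => /ctx0.
  split=> [| |u' w' lt'|w']; first exact: sound_upd.
  - by rewrite upd_neq // updE.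
  - by rewrite !upd_neq //; apply: J1.
  - by rewrite leqNgt ltn_ord.
move=> w m2 ltw [s2 u2 h1 h2]; pose w0 := Ordinal ltw.
have s2' : sound (upd m2 11 w) by apply: sound_upd.
have u2' : upd m2 11 w 10 = u by rewrite upd_neq.
have [s3 u3 keep hit] := den_search_body (w := w0) U s2' u2' (updE _ _ _).
split=> //.
- move=> u' w' lt' P; apply: keep; rewrite upd_neq //; exact: h1 P.
- move=> w'; rewrite leq_eqVlt => /orP[/eqP ww'|lt'] P.
    by apply: hit; have <- : w' = w0 by apply: val_inj.
  by apply: keep; rewrite upd_neq //; apply: h2 P.
Qed.

End Correctness.

(** * Exhaustive search and the running time *)

Definition bit (j i : nat) : bool := odd (j %/ 2 ^ i).

Lemma bit0 j : bit j 0 = odd j.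
Proof. by rewrite /bit expn0 divn1. Qed.

Lemma bitS j i : bit j i.+1 = bit j./2 i.
Proof. by rewrite /bit expnS divnMA divn2. Qed.

Lemma bit_small j n i : j < 2 ^ n -> n <= i -> bit j i = false.
Proof.
by move=> jn ni; rewrite /bit divn_small // (leq_trans jn) // leq_exp2l.
Qed.

Lemma bit_add_exp j n i : i < n -> bit (2 ^ n + j) i = bit j i.
Proof.
move=> lt; rewrite /bit divnDl ?dvdn_exp2l ?(ltnW lt) // oddD.
by rewrite -(expnB (isT : 0 < 2) (ltnW lt)) oddX subn_eq0 leqNgt lt.
Qed.

Lemma bits_exist (n : nat) (f : nat -> bool) :
  exists2 j, j < 2 ^ n & forall i, i < n -> bit j i = f i.
Proof.
elim: n f => [|n IH] f; first by exists 0.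
have [j lt h] := IH (fun i => f i.+1).
exists (f 0 + j.*2) => [|[|i] lti].
- by rewrite expnS; move: lt; case: (f 0); lia.
- by rewrite bit0 oddD odd_double addbF oddb.
- by rewrite bitS half_bit_double h.
Qed.

(** The colour array serves as a binary counter, lowest bit first. The loop clears the trailing
    ones, leaving in cell 16 the address of the first zero, where [increment] then writes 1. *)
Definition increment_loop : program :=
  While 7 (Seq (Store 16 2) (Seq (Add 16 16 1) (Fetch 7 16))).

Definition increment : program :=
  Seq (Add 16 3 2) (Seq (Fetch 7 16) (Seq increment_loop (Store 16 1))).

(** Cells 0 and 2 already hold [n] and 0; cell 9 starts nonzero so that the search can begin. *)
Definition prologue (k : nat) : program :=
  Seq (Const 1 1) (Seq (Const 3 (color_base k)) (Seq (Const 4 k)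
    (Seq (Const 5 tuple_base) (Const 9 1)))).

Definition exhaustive (k : nat) : program :=
  While 9 (Seq increment (compile (check_code k))).

(** Cell 0 holds [n] until the very end, when the output convention requires the address of the
    array there. *)
Definition algorithm (k : nat) : program :=
  Seq (prologue k) (Seq (compile (search_code k))
    (Seq (exhaustive k) (Const 0 (color_base k)))).

Section Run.
Variables (k n : nat) (H : {set {set 'I_n}}).
Hypothesis k_gt0 : 0 < k.
Implicit Type m : memory.

(** Strong induction on [j]: an odd [j] has its lowest bit cleared, and the carry moves on to [j./2]
    at address [a + 1]. A pass takes 6 steps, and there are at most [j] of them. *)
Lemma eval_increment_loop j a m :
  m 1 = 1 -> m 2 = 0 -> 16 < a -> m 16 = a -> m 7 = m a ->
  (forall i, m (a + i) = bit j i) ->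
  exists m' t, [/\ t <= 6 * j + 1, eval k H increment_loop m m' t,
    a <= m' 16, forall i, upd m' (m' 16) 1 (a + i) = bit j.+1 i &
    forall x, x < a -> x != 7 -> x != 16 -> m' x = m x].
Proof.
elim/ltn_ind: j a m => j IH a m m1 m2 a16 m16 m7 rep.
have ma : m a = odd j by have := rep 0; rewrite addn0 bit0.
case: (boolP (odd j)) => oj; last first.
  exists m, 1; split => //; first by rewrite addn1.
  - by apply: eval_while_false; rewrite m7 ma (negPf oj).
  - by rewrite m16.
  move=> [|i]; rewrite m16.
    by rewrite addn0 updE bit0 /= oj.
  rewrite upd_neq ?rep ?bitS; last by lia.
  by congr (nat_of_bool (bit _ i)); rewrite -[in RHS](even_halfK oj); lia.
pose m3 := upd (upd (upd m a 0) 16 a.+1) 7 (m a.+1).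
have m3E x : x != a -> x != 16 -> x != 7 -> m3 x = m x.
  by move=> xa x16 x7; rewrite /m3 !upd_neq.
have m3a : m3 a = 0.
  by rewrite /m3 upd_neq; [rewrite upd_neq; [rewrite updE|lia]|lia].
have body : eval k H (Seq (Store 16 2) (Seq (Add 16 16 1) (Fetch 7 16))) m m3 5.
  move=> K; rewrite /= m2 m16 /m3.
  have -> : upd m a 0 16 + upd m a 0 1 = a.+1.
    by rewrite !upd_neq ?m16 ?m1 ?addn1 //; lia.
  rewrite updE; congr (_, upd _ _ _); rewrite !upd_neq //; lia.
have jE : j = (j./2).*2.+1 by rewrite -[LHS]odd_double_half oj.
have ltj : j./2 < j by lia.
have [] := IH _ ltj a.+1 m3.
- by rewrite m3E //; lia.
- by rewrite m3E //; lia.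
- by lia.
- by rewrite /m3 upd_neq // updE.
- by rewrite [LHS]/m3 updE m3E //; lia.
- by move=> i; rewrite m3E; [rewrite addSnnS rep bitS|lia|lia|lia].
move=> m' [t [le E a' rep' fr]]; exists m', (5 + t).+1; split.
- by lia.
- by apply: eval_while_true body E; rewrite m7 ma oj.
- by lia.
- move=> [|i].
    rewrite addn0 upd_neq; last by lia.
    rewrite fr; [|lia|lia|lia].
    by rewrite m3a bit0 /= oj.
  rewrite -addSnnS rep' bitS; congr (nat_of_bool (bit _ i)); lia.
- by move=> x xa x7 x16; rewrite fr ?m3E //; lia.
Qed.

Lemma eval_increment j m : ctx k n m ->
  (forall i, m (color_base k + i) = bit j i) ->
  exists m' t, [/\ t <= 6 * j + 7, eval k H increment m m' t, ctx k n m' &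
    forall i, m' (color_base k + i) = bit j.+1 i].
Proof.
move=> cm rep; set B := color_base k in rep *.
have B20 : 20 <= B by rewrite /B /color_base leq_addr.
pose m1 := upd m 16 B; pose m2 := upd m1 7 (m1 B).
have m2E x : x != 7 -> x != 16 -> m2 x = m x.
  by move=> x7 x16; rewrite /m2 /m1 !upd_neq.
have [] := @eval_increment_loop j B m2.
- by rewrite m2E // (ctx1 cm).
- by rewrite m2E // (ctx2 cm).
- by lia.
- by rewrite /m2 upd_neq // /m1 updE.
- by rewrite [LHS]/m2 updE /m2 [RHS]upd_neq //; lia.
- by move=> i; rewrite m2E ?rep //; lia.
move=> m3 [t [le E a3 rep3 fr]].
have m31 : m3 1 = 1 by rewrite fr ?m2E ?(ctx1 cm) //; lia.
exists (upd m3 (m3 16) 1), (1 + (1 + (t + 1).+1).+1).+1; split => //.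
- by lia.
- apply: (@eval_seq _ _ _ _ _ _ m1) => [K|].
    by rewrite /= (ctx3 cm) (ctx2 cm) addn0.
  apply: (@eval_seq _ _ _ _ _ _ m2) => [K|].
    by rewrite /= /m2 /m1 updE.
  by apply: eval_seq E _ => K; rewrite /= m31.
- apply: ctx_eq cm => x x6; rewrite upd_neq; last by lia.
  by rewrite fr ?m2E //; lia.
Qed.

(** [J] encodes a known proper colouring and [d] bounds the remaining distance. The counter cannot
    pass [J], because the check made there sets cell 9 to 0. *)
Lemma eval_exhaustive J d j m :
  uniform k H ->
  proper_coloring H [ffun v : 'I_n => bit J v] ->
  ctx k n m -> (forall i, m (color_base k + i) = bit j i) ->
  (m 9 = 0 -> proper_coloring H (coloring_of k n m)) -> (m 9 != 0 -> j < J <= j + d) ->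
  exists m' t, [/\ t <= d * (6 * J + 9 + cost n (check_code k)) + 1,
    eval k H (exhaustive k) m m' t & proper_coloring H (coloring_of k n m')].
Proof.
move=> U PJ; elim: d j m => [|d IH] j m cm rep m9 jJ.
  exists m, 1; have m90 : m 9 = 0.
    by apply/eqP; apply: contraT => /jJ; lia.
  by split; [|apply: eval_while_false|apply: m9].
have [m90|m91] := eqVneq (m 9) 0.
  by exists m, 1; split; [rewrite leq_addl|apply: eval_while_false|apply: m9].
have [m1 [t1 [le1 E1 c1 rep1]]] := eval_increment cm rep.
have [t2 le2 E2] := eval_compile H (well_formed_check k_gt0) c1.
set m2 := den k H (check_code k) m1 in E2.
have B20 : 20 < color_base k by rewrite /color_base /tuple_base; lia.
have m2E i : m2 (color_base k + i) = m1 (color_base k + i).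
  by rewrite /m2 frame_check // mem_tuple_cells; lia.
have col : coloring_of k n m2 = coloring_of k n m1.
  by apply/ffunP => v; rewrite !ffunE m2E.
have CP : (m2 9 == 0) = proper_coloring H (coloring_of k n m2).
  rewrite col -check_proper // => x; rewrite rep1; exact: leq_b1.
have [|||] := IH j.+1 m2 (den_ctx H (well_formed_check k_gt0) c1).
- by move=> i; rewrite m2E rep1.
- by move=> /eqP; rewrite CP.
- move=> m29; suff jJ' : j.+1 != J by have := jJ m91; lia.
  apply: contraNneq m29 => jJ'; rewrite CP col.
  rewrite (_ : coloring_of k n m1 = [ffun v : 'I_n => bit J v]) //.
  by apply/ffunP => v; rewrite !ffunE rep1 jJ'; case: bit.
move=> m' [t [le E P]]; exists m', ((t1 + t2).+1 + t).+1; split => //.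
  have := jJ m91; move: le le1 le2; set c := cost _ _; nia.
apply: eval_while_true E => //; exact: eval_seq E1 E2.
Qed.

Definition exhaustive_time : nat :=
  2 ^ n.+1 * (6 * 2 ^ n.+1 + 9 + cost n (check_code k)).

Lemma eval_algorithm : uniform k H -> two_colorable H ->
  exists t m, [/\ t <= cost n (search_code k) + 20 + bad H * exhaustive_time,
    eval k H (algorithm k) (fun a => if a == 0 then n else 0) m t &
    proper_coloring H [ffun v : 'I_n => m (m 0 + v) != 0]].
Proof.
move=> U /existsP[c Pc]; pose m0 : memory := fun a => if a == 0 then n else 0.
rewrite -/m0; set B := color_base k.
have B20 : 20 <= B by rewrite /B /color_base leq_addr.
pose m1 := upd (upd (upd (upd (upd m0 1 1) 3 B) 4 k) 5 tuple_base) 9 1.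
have E1 : eval k H (prologue k) m0 m1 9 by [].
have m1B i : m1 (B + i) = 0.
  rewrite /m1 !upd_neq; try lia.
  by rewrite /m0; case: eqP => //; lia.
have s1 : sound k H m1.
  split => //; split=> [x|x _]; by rewrite m1B.
have c1 : ctx k n m1 by case: s1.
have [t2 le2 E2] := eval_compile H (well_formed_search k_gt0) c1.
have [s2 good] := den_search k_gt0 U s1.
set m2 := den k H (search_code k) m1 in E2 s2 good.
suff [m3 [t3 [le3 E3 P3]]] : exists m3 t3, [/\ t3 <= bad H * exhaustive_time + 1,
    eval k H (exhaustive k) m2 m3 t3 & proper_coloring H (coloring_of k n m3)].
  exists (9 + (t2 + (t3 + 1).+1).+1).+1, (upd m3 0 B); split.
  - by lia.
  - apply: eval_seq E1 _; apply: eval_seq E2 _; apply: eval_seq E3 _.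
    by move=> K.
  - exact: P3.
case: s2 => c2 [b1 b2] P2.
have [m29|m29] := eqVneq (m2 9) 0.
  by exists m2, 1; split; [rewrite leq_addl|apply: eval_while_false|apply: P2].
have -> : bad H = true by apply: contraT => /good/eqP; rewrite (negPf m29).
(* The colours left by the codegree search serve as the initial value j < 2^n of
   the binary counter, and cells beyond the n-th may be used for carries: the
   value 2^n + J encodes the same colouring as J and is certainly reached. *)
have [j ltj bj] := bits_exist n (fun i => m2 (B + i) != 0).
have [J ltJ bJ] := bits_exist n (fun i => if insub i is Some v then c v else false).
have repj i : m2 (B + i) = bit j i.
  have [lt|ge] := ltnP i n; last by rewrite (bit_small ltj ge); apply: b2.
  by rewrite bj //; have := b1 i; rewrite -/B; case: (m2 (B + i)) => [|[|]].
have cJ : [ffun v : 'I_n => bit (2 ^ n + J) v] = c.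
  by apply/ffunP => v; rewrite ffunE bit_add_exp // bJ // valK.
have PJ : proper_coloring H [ffun v : 'I_n => bit (2 ^ n + J) v] by rewrite cJ.
have jJ : m2 9 != 0 -> j < 2 ^ n + J <= j + 2 ^ n.+1 by rewrite expnS; lia.
have [m3 [t3 [le3 E3 P3]]] := eval_exhaustive U PJ c2 repj P2 jJ.
exists m3, t3; split=> //; apply: leq_trans le3 _.
rewrite mul1n /exhaustive_time leq_add2r leq_mul2l; apply/orP; right.
by rewrite expnS; lia.
Qed.

Lemma halted_algorithm : uniform k H -> two_colorable H ->
  exists t, [/\ t <= cost n (search_code k) + 20 + bad H * exhaustive_time,
    halted (run k (algorithm k) H t) &
    proper_coloring H (output n (run k (algorithm k) H t))].
Proof.
move=> U C; have [t [m [le E P]]] := eval_algorithm U C.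
by exists t; split=> //; rewrite /run /init E.
Qed.

End Run.

(** * The average running time *)

Lemma running_time_leq (k n : nat) (A : program) (H : {set {set 'I_n}}) (t : nat) :
  halted (run k A H t) -> running_time k A H <= t.
Proof.
move=> h; rewrite /running_time; case: pselect => // ex.
by case: ex_minnP => s _; apply.
Qed.

Lemma loop_depth_nest s p : loop_depth (nest s p) = size s + loop_depth p.
Proof. by elim: s => //= x s ->. Qed.

Lemma loop_depth_check k : loop_depth (check_code k) = k.
Proof.
rewrite /= loop_depth_nest size_map size_iota /= max0n.
suff -> : loop_depth (color_sum (tuple_cells k)) = 0 by rewrite !maxn0 addn0.
by elim: (tuple_cells k) => //= r s ->.
Qed.

(** Two loops over [u] and [w] enclose either a check of depth [k] or the loop over [v] around
    codegrees of depth [k - 1]. *)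
Lemma loop_depth_search k : 0 < k -> loop_depth (search_code k) <= k.+2.
Proof.
move=> k0; have fillE : loop_depth (fill_body k) <= k.-1.
  by rewrite /= !loop_depth_nest size_map size_iota /= !maxn0 !max0n !addn0 maxnn.
have := loop_depth_check k; rewrite /search_code.
move: (fill_body k) (check_code k) fillE => f c /= fE ->.
by rewrite maxn0 !ltnS geq_max leqnn andbT -(ltn_predK k0) ltnS.
Qed.

Lemma exhaustive_time_leq k n :
  exhaustive_time k n <= 4 ^ n * (24 + 18 + 2 * cost n (check_code k)).
Proof.
rewrite /exhaustive_time; move: (cost _ _) => c.
have -> : 4 ^ n = 2 ^ n * 2 ^ n by rewrite -expnMn.
rewrite expnS; have : 0 < 2 ^ n by rewrite expn_gt0.
by move: (2 ^ n) => x x0; nia.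
Qed.

Theorem theorem1p1 :
  exists C : nat, forall k : nat, (3 <= k)%N ->
  exists A : program,
    finds_proper_2coloring k A /\
    exists n0 : nat, forall n : nat, (n0 <= n)%N ->
      (average_running_time k A n <= (n%:R : rat) ^+ (C * k)%N)%R.
Proof.
(* The final degree is [k + 3], at most [2 * k] for [k >= 3]. *)
exists 2 => k k3; have k0 : 0 < k by lia.
exists (algorithm k); split.
  move=> n H U C; have [t [_ h P]] := halted_algorithm k0 U C.
  by exists t.
pose s := code_size (search_code k); pose c := code_size (check_code k).
(* The first two summands serve [bad_card]; the last lets one factor [n] absorb all constants, with
   [2 ^ k.+2] coming from [n + 1 <= 2 * n]. *)
exists (280 * tail_ratio k ^ 2 + 4 * k + (s + 20 + 42 + 2 * c) * 2 ^ k.+2) => n nl.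
have n_gt0 : 0 < n by lia.
rewrite /average_running_time; set S := (\sum_(H | _) _)%N; set X := [set H | _].
have X0 : 0 < #|X|.
  apply/card_gt0P; exists set0; rewrite inE; apply/andP; split.
    by apply/forallP => e; rewrite inE.
  by apply/existsP; exists [ffun=> true]; apply: proper_coloring_empty.
rewrite ler_pdivrMr ?ltr0n // -natrX -natrM ler_nat.
set P := cost n (search_code k) + 20.
have SX : S <= #|X| * P +
    #|[set H : {set {set 'I_n}} | [&& uniform k H, two_colorable H & bad H]]|
      * exhaustive_time k n.
  apply: leq_trans (_ : \sum_(H in X) (P + bad H * exhaustive_time k n) <= _).
    rewrite /S (eq_bigl (mem X)); last by move=> H; rewrite !inE.
    apply: leq_sum => H; rewrite !inE => /andP[U C].
    have [t [le h _]] := halted_algorithm k0 U C.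
    exact: leq_trans (running_time_leq h) le.
  rewrite big_split /= sum_nat_const leq_add2l -big_distrl /= leq_mul2r.
  apply/orP; right; rewrite -sum1_card [leqRHS]big_mkcond [leqLHS]big_mkcond.
  apply: leq_sum => H _; rewrite !inE.
  by case: (uniform k H); case: (two_colorable H); case: (bad H).
apply: leq_trans SX _.
have B := bad_card k3 (leq_trans (leq_addr _ _) nl); rewrite -/X in B.
set Y := #|_| in B *; set N := #|X| in X0 B *.
set K := 42 + 2 * cost n (check_code k).
(* The bad hypergraphs are a fraction of at most [n / 4 ^ n], which cancels the [4 ^ n] of the
   exhaustive search. *)
have YE : Y * exhaustive_time k n <= N * (n * K).
  apply: leq_trans (_ : Y * (4 ^ n * K) <= _).
    by rewrite leq_mul2l exhaustive_time_leq orbT.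
  by rewrite mulnA [leqRHS]mulnA [N * n]mulnC leq_mul2r B orbT.
apply: leq_trans (_ : N * P + N * (n * K) <= _); first by rewrite leq_add2l.
rewrite -mulnDr [leqRHS]mulnC leq_mul2l; apply/orP; right.
pose Z := n.+1 ^ k.+2.
have Z1 : n.+1 <= Z by rewrite /Z expnS leq_pmulr // expn_gt0.
have PZ : P <= (s + 20) * Z.
  have : cost n (search_code k) <= s * Z.
    apply: leq_trans (cost_leq _ _) _; rewrite leq_mul2l leq_pexp2l ?orbT //.
    exact: loop_depth_search.
  by rewrite /P mulnDl; nia.
(* The extra factor [n] meets a check of degree only [k], so degree [k + 2] still suffices. *)
have KZ : n * K <= (42 + 2 * c) * Z.
  have : cost n (check_code k) <= c * n.+1 ^ k.
    by apply: leq_trans (cost_leq _ _) _; rewrite loop_depth_check.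
  rewrite /K /Z; set y := cost _ _; rewrite !expnS; set x := n.+1 ^ k.
  have : 0 < x by rewrite expn_gt0.
  move=> x0 yx; apply: leq_trans (_ : n * (42 * x + 2 * (c * x)) <= _).
    by rewrite leq_mul2l; apply/orP; right; lia.
  rewrite -[leqLHS]/(n * _) (_ : 42 * x + 2 * (c * x) = (42 + 2 * c) * x); last by lia.
  rewrite mulnCA leq_mul2l; apply/orP; right; nia.
apply: leq_trans (_ : (s + 20 + 42 + 2 * c) * Z <= _).
  by rewrite -(addnA (s + 20)) mulnDl leq_add.
have Z2 : Z <= 2 ^ k.+2 * n ^ k.+2.
  by rewrite /Z -expnMn leq_exp2r //; lia.
apply: leq_trans (_ : n * n ^ k.+2 <= _); last first.
  by rewrite -expnS leq_pexp2l //; lia.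
apply: leq_trans (_ : (s + 20 + 42 + 2 * c) * (2 ^ k.+2 * n ^ k.+2) <= _).
  by rewrite leq_mul2l Z2 orbT.
by rewrite mulnA leq_mul2r; apply/orP; right; apply: leq_trans nl; rewrite leq_addl.
Qed.
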